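(* Let $(M^n,g)$ be a complex nilmanifold with nilpotent complex structure $J$; that is, the universal covering space of $(M^n,g)$, as a Hermitian manifold, is $(G,J,g)$, where $G$ is a nilpotent Lie group equipped with a left-invariant complex structure $J$ and a compatible left-invariant metric, and $J$ is nilpotent. If $H^s=f$ where $f$ is a function on $M^n$, then $f\equiv0$, $g$ is Kähler and flat, and $G$ is abelian.
   Context: For a Hermitian manifold $(M^n,g)$ with complex structure $J$, write $\langle\,,\rangle$ for $g$ extended complex-bilinearly. The Strominger (Bismut) connection $\nabla^s$ is the unique connection with $\nabla^s g=0$, $\nabla^s J=0$ and totally skew-symmetric torsion. Its curvature is $R^s_{XYZW}=\langle \nabla^s_X\nabla^s_YZ-\nabla^s_Y\nabla^s_XZ-\nabla^s_{[X,Y]}Z,\,W\rangle$, and its holomorphic sectional curvature is $H^s(X)=R^s_{X\overline X X\overline X}/|X|^4$, with $|X|^2=\langle X,\overline X\rangle$, for nonzero $X$ of type $(1,0)$. ''$H^s=f$'' means $H^s(X)=f(p)$ for every $p\in M$ and every nonzero $(1,0)$-vector $X$ at $p$. Nilpotency of $J$ is in the sense of Cordero–Fernández–Gray–Ugarte: with $\mathfrak g$ the Lie algebra of $G$, define $\mathfrak a_0=0$ and $\mathfrak a_k=\{x\in\mathfrak g:\ [x,\mathfrak g]\subseteq\mathfrak a_{k-1},\ [Jx,\mathfrak g]\subseteq\mathfrak a_{k-1}\}$ for $k\ge1$; $J$ is nilpotent if $\mathfrak a_k=\mathfrak g$ for some $k$. As a consequence, there is a left-invariant unitary frame $\{e_1,\dots,e_n\}$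 of $(1,0)$-vectors on $G$ such that $C^j_{ik}=\langle[e_i,e_k],\overline{e_j}\rangle$ vanishes unless $j>i$ and $j>k$, and $D^j_{ik}=\langle[\overline{e_j},e_k],e_i\rangle$ vanishes unless $i>j$ and $i>k$. *)

(* Defs.v *)
From HB Require Import structures.
From mathcomp Require Import all_boot all_order all_algebra.
From mathcomp Require Import all_classical all_reals all_analysis.
From mathcomp Require Import complex.

Set Implicit Arguments.
Unset Strict Implicit.
Unset Printing Implicit Defensive.

Import Order.TTheory GRing.Theory Num.Theory.
Import numFieldNormedType.Exports.

Local Open Scope classical_set_scope.
Local Open Scope ring_scope.

(* No compatibility is asserted between topology and group law here: it is part
   of [is_lie_group]. *)
#[short(type="groupSpaceType")]
HB.structure Definition GroupSpace := {G of Topological G & Group G}.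

Section SmoothFunctionsOnRm.
Context {R : realType} {m : nat}.

Fixpoint Ck (k : nat) (V : set 'rV[R]_m) (f : 'rV[R]_m -> R) : Prop :=
  match k with
  | 0 => forall x, V x -> {for x, continuous f}
  | k'.+1 => (forall x, V x -> differentiable f x) /\
             forall i : 'I_m, Ck k' V (fun x => 'D_(delta_mx ord0 i) f x)
  end.

Definition smooth_germ (x : 'rV[R]_m) (f : 'rV[R]_m -> R) : Prop :=
  exists V, [/\ open V, V x & forall k, Ck k V f].

End SmoothFunctionsOnRm.

(* Raw data; the conditions on charts are imposed in [is_manifold].  The maps
   are total, only their behaviour on [cdom] and [cmap @` cdom] matters. *)
Record chart (R : realType) (m : nat) (T : topologicalType) := Chart {
  cdom : set T;
  cmap : T -> 'rV[R]_m;
  cinv : 'rV[R]_m -> T }.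

Section Manifolds.
Context {R : realType} {m : nat} {M : topologicalType}.
Implicit Type A : set (chart R m M).

Record is_manifold A : Prop := IsManifold {
  man_hausdorff : hausdorff_space M;
  man_second_countable : @second_countable M;
  man_cover : forall p, exists2 c, A c & cdom c p;
  man_open_dom : forall c, A c -> open (cdom c);
  man_open_img : forall c, A c -> open (cmap c @` cdom c);
  man_cmapK : forall c p, A c -> cdom c p -> cinv c (cmap c p) = p;
  man_cmap_continuous : forall c p,
    A c -> cdom c p -> {for p, continuous (cmap c)};
  man_cinv_continuous : forall c p,
    A c -> cdom c p -> {for cmap c p, continuous (cinv c)};
  man_transition : forall c d p (j : 'I_m),
    A c -> A d -> cdom c p -> cdom d p ->
    smooth_germ (cmap c p) (fun x => cmap d (cinv c x) ord0 j) }.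

(* [f] is C^oo in a neighbourhood of [p]. *)
Definition smooth_at A (p : M) (f : M -> R) : Prop :=
  forall c, A c -> cdom c p -> smooth_germ (cmap c p) (f \o cinv c).

End Manifolds.

Definition smooth_map_at (R : realType) (m n : nat) (M N : topologicalType)
    (A : set (chart R m M)) (B : set (chart R n N)) (F : M -> N) (p : M) :=
  {for p, continuous F} /\
  forall f, smooth_at B (F p) f -> smooth_at A p (f \o F).

Definition prod_chart (R : realType) (m n : nat) (M N : topologicalType)
    (c : chart R m M) (d : chart R n N) : chart R (m + n) (M * N)%type :=
  Chart (cdom c `*` cdom d)
        (fun q => row_mx (cmap c q.1) (cmap d q.2))
        (fun z => (cinv c (lsubmx z), cinv d (rsubmx z))).

Definition prod_atlas (R : realType) (m n : nat) (M N : topologicalType)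
    (A : set (chart R m M)) (B : set (chart R n N)) :
    set (chart R (m + n) (M * N)%type) :=
  [set e | exists c d, [/\ A c, B d & e = prod_chart c d]].

(* Tangent vectors at [p] act on germs of smooth functions at [p].  They are
   totalized by the value 0 on functions which are not smooth near [p], so that
   two tangent vectors are equal as functionals iff they agree on germs. *)
Definition tvec (R : realType) (M : Type) := (M -> R) -> R.
Definition vfield (R : realType) (M : Type) := M -> tvec R M.

Section TangentVectors.
Context {R : realType} {m : nat} {M : topologicalType}.
Variable A : set (chart R m M).

Definition tangent (p : M) (v : tvec R M) : Prop :=
  exists (c : chart R m M) (a : 'rV[R]_m), [/\ A c, cdom c p &
    v = fun f => if `[< smooth_at A p f >]
                 then 'D_a (f \o cinv c) (cmap c p) else 0].

(* [X] is a smooth vector field in a neighbourhood of [p]. *)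
Definition smooth_field_at (p : M) (X : vfield R M) : Prop :=
  (\forall q \near p, tangent q (X q)) /\
  forall f, smooth_at A p f -> smooth_at A p (fun q => X q f).

Definition bracket (X Y : vfield R M) : vfield R M := fun p f =>
  if `[< smooth_at A p f >]
  then X p (fun q => Y q f) - Y p (fun q => X q f) else 0.

End TangentVectors.

Definition pushforward (R : realType) (n : nat) (M N : topologicalType)
    (B : set (chart R n N)) (F : M -> N) (p : M) (v : tvec R M) : tvec R N :=
  fun f => if `[< smooth_at B (F p) f >] then v (f \o F) else 0.

(* All the data below ([J], [g], connections) are total; their values are
   constrained only on tangent vectors and on germs of smooth vector fields. *)
Section HermitianGeometry.
Context {R : realType} {m : nat} {M : topologicalType}.
Variable A : set (chart R m M).

Definition endo_field := M -> tvec R M -> tvec R M.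
Definition bilinear_field := M -> tvec R M -> tvec R M -> R.
(* [D p v Y] is the covariant derivative at [p] of [Y] in the direction [v]. *)
Definition covariant_op := M -> tvec R M -> vfield R M -> tvec R M.

Definition appJ (J : endo_field) (X : vfield R M) : vfield R M :=
  fun q => J q (X q).

Record is_complex_structure (J : endo_field) : Prop := IsComplexStructure {
  cs_tangent : forall p v, tangent A p v -> tangent A p (J p v);
  cs_linear : forall p (a : R) v w, tangent A p v -> tangent A p w ->
    J p (a *: v + w) = a *: J p v + J p w;
  cs_square : forall p v, tangent A p v -> J p (J p v) = - v;
  cs_smooth : forall p X,
    smooth_field_at A p X -> smooth_field_at A p (appJ J X);
  cs_integrable : forall p X Y,
    smooth_field_at A p X -> smooth_field_at A p Y ->
    bracket A (appJ J X) (appJ J Y) p - J p (bracket A (appJ J X) Y p)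
      - J p (bracket A X (appJ J Y) p) - bracket A X Y p = 0 }.

Record is_riemannian (g : bilinear_field) : Prop := IsRiemannian {
  rm_linear : forall p (a : R) u v w,
    tangent A p u -> tangent A p v -> tangent A p w ->
    g p (a *: u + v) w = a * g p u w + g p v w;
  rm_sym : forall p v w,
    tangent A p v -> tangent A p w -> g p v w = g p w v;
  rm_pos : forall p v, tangent A p v -> v <> 0 -> 0 < g p v v;
  rm_smooth : forall p X Y, smooth_field_at A p X -> smooth_field_at A p Y ->
    smooth_at A p (fun q => g q (X q) (Y q)) }.

Record is_hermitian (J : endo_field) (g : bilinear_field) : Prop :=
  IsHermitian {
  herm_manifold : is_manifold A;
  herm_complex : is_complex_structure J;
  herm_riemannian : is_riemannian g;
  herm_compatible : forall p v w, tangent A p v -> tangent A p w ->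
    g p (J p v) (J p w) = g p v w }.

Definition kahler_form (J : endo_field) (g : bilinear_field) :
    bilinear_field := fun p v w => g p (J p v) w.

Definition ext_deriv2 (w : bilinear_field) (X Y Z : vfield R M) (p : M) : R :=
  X p (fun q => w q (Y q) (Z q)) - Y p (fun q => w q (X q) (Z q))
  + Z p (fun q => w q (X q) (Y q))
  - w p (bracket A X Y p) (Z p) + w p (bracket A X Z p) (Y p)
  - w p (bracket A Y Z p) (X p).

Definition is_kahler (J : endo_field) (g : bilinear_field) : Prop :=
  forall p X Y Z, smooth_field_at A p X -> smooth_field_at A p Y ->
    smooth_field_at A p Z -> ext_deriv2 (kahler_form J g) X Y Z p = 0.

Record is_connection (D : covariant_op) : Prop := IsConnection {
  conn_tangent : forall p v Y, tangent A p v -> smooth_field_at A p Y ->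
    tangent A p (D p v Y);
  conn_local : forall p v Y Y', tangent A p v ->
    smooth_field_at A p Y -> smooth_field_at A p Y' ->
    (\forall q \near p, Y q = Y' q) -> D p v Y = D p v Y';
  conn_linear : forall p (a : R) v w Y,
    tangent A p v -> tangent A p w -> smooth_field_at A p Y ->
    D p (a *: v + w) Y = a *: D p v Y + D p w Y;
  conn_add : forall p v Y Z, tangent A p v ->
    smooth_field_at A p Y -> smooth_field_at A p Z ->
    D p v (Y + Z) = D p v Y + D p v Z;
  conn_leibniz : forall p v f Y, tangent A p v ->
    smooth_at A p f -> smooth_field_at A p Y ->
    D p v (fun q => f q *: Y q) = v f *: Y p + f p *: D p v Y;
  conn_smooth : forall p X Y, smooth_field_at A p X -> smooth_field_at A p Y ->
    smooth_field_at A p (fun q => D q (X q) Y) }.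

Definition metric_connection (g : bilinear_field) (D : covariant_op) : Prop :=
  forall p v Y Z, tangent A p v ->
    smooth_field_at A p Y -> smooth_field_at A p Z ->
    v (fun q => g q (Y q) (Z q)) = g p (D p v Y) (Z p) + g p (Y p) (D p v Z).

Definition torsion (D : covariant_op) (X Y : vfield R M) : vfield R M :=
  fun p => D p (X p) Y - D p (Y p) X - bracket A X Y p.

Definition curvature (D : covariant_op) (X Y Z : vfield R M) : vfield R M :=
  fun p => D p (X p) (fun q => D q (Y q) Z) - D p (Y p) (fun q => D q (X q) Z)
           - D p (bracket A X Y p) Z.

Record is_levi_civita (g : bilinear_field) (D : covariant_op) : Prop :=
  IsLeviCivita {
  lc_connection : is_connection D;
  lc_metric : metric_connection g D;
  lc_torsion_free : forall p X Y,
    smooth_field_at A p X -> smooth_field_at A p Y -> torsion D X Y p = 0 }.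

(* The Levi-Civita connection is unique on germs of smooth fields. *)
Definition is_flat (g : bilinear_field) : Prop :=
  exists2 D, is_levi_civita g D & forall p X Y Z,
    smooth_field_at A p X -> smooth_field_at A p Y -> smooth_field_at A p Z ->
    curvature D X Y Z p = 0.

(* Skew-symmetry of the torsion 3-form in its first two arguments holds by
   definition, so skew-symmetry in the last two means totally skew. *)
Record is_strominger (J : endo_field) (g : bilinear_field)
    (D : covariant_op) : Prop := IsStrominger {
  st_connection : is_connection D;
  st_metric : metric_connection g D;
  st_complex : forall p v Y, tangent A p v -> smooth_field_at A p Y ->
    D p v (appJ J Y) = J p (D p v Y);
  st_torsion_skew : forall p X Y Z, smooth_field_at A p X ->
    smooth_field_at A p Y -> smooth_field_at A p Z ->
    g p (torsion D X Y p) (Z p) = - g p (torsion D X Z p) (Y p) }.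

(* A complex vector field [x + i y] is the pair [(x, y)] of real ones. *)
Definition cfield := (vfield R M * vfield R M)%type.
Definition cconj (X : cfield) : cfield := (X.1, - X.2).
Definition cpart (b : bool) (X : cfield) : vfield R M := if b then X.2 else X.1.

Definition complexify2 (B : vfield R M -> vfield R M -> R) (X Y : cfield) :
    R[i] :=
  \sum_(a : bool) \sum_(b : bool)
    'i%C ^+ (a + b) * (B (cpart a X) (cpart b Y))%:C%C.

Definition complexify4
    (T : vfield R M -> vfield R M -> vfield R M -> vfield R M -> R)
    (X Y Z W : cfield) : R[i] :=
  \sum_(a : bool) \sum_(b : bool) \sum_(c : bool) \sum_(d : bool)
    'i%C ^+ (a + b + c + d) *
    (T (cpart a X) (cpart b Y) (cpart c Z) (cpart d W))%:C%C.

Definition cmetric (g : bilinear_field) (p : M) : cfield -> cfield -> R[i] :=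
  complexify2 (fun X Y => g p (X p) (Y p)).

Definition ccurvature4 (g : bilinear_field) (D : covariant_op) (p : M) :
    cfield -> cfield -> cfield -> cfield -> R[i] :=
  complexify4 (fun X Y Z W => g p (curvature D X Y Z p) (W p)).

(* The value [x + i y] at [p] satisfies J (x + i y) = i (x + i y). *)
Definition type10_at (J : endo_field) (p : M) (X : cfield) : Prop :=
  J p (X.1 p) = - X.2 p /\ J p (X.2 p) = X.1 p.

Definition hol_sect_curv (g : bilinear_field) (D : covariant_op) (p : M)
    (X : cfield) : R[i] :=
  ccurvature4 g D p X (cconj X) X (cconj X) / cmetric g p X (cconj X) ^+ 2.

(* By tensoriality [hol_sect_curv g D p X] depends only on the value of [X]
   at [p], and every tangent vector at [p] extends to a germ of smooth field:
   quantifying over germs is quantifying over (1,0)-vectors at [p]. *)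
Definition hol_sect_curv_eq (J : endo_field) (g : bilinear_field)
    (D : covariant_op) (f : M -> R) : Prop :=
  forall (p : M) (X : cfield),
    smooth_field_at A p X.1 -> smooth_field_at A p X.2 ->
    type10_at J p X -> (X.1 p, X.2 p) <> (0, 0) ->
    hol_sect_curv g D p X = (f p)%:C%C.

End HermitianGeometry.

Section LieGroups.
Context {R : realType} {m : nat} {G : groupSpaceType}.
Variable A : set (chart R m G).

Record is_lie_group : Prop := IsLieGroup {
  lie_manifold : is_manifold A;
  lie_mul : forall z : G * G,
    smooth_map_at (prod_atlas A A) A (fun z => z.1 * z.2)%g z;
  lie_inv : forall x : G, smooth_map_at A A (fun x => x^-1)%g x }.

Definition ltrans (a b : G) : G := (a * b)%g.

Definition left_invariant_endo (J : endo_field (R := R) (M := G)) : Prop :=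
  forall a b v, tangent A b v ->
    J (a * b)%g (pushforward A (ltrans a) b v)
    = pushforward A (ltrans a) b (J b v).

Definition left_invariant_metric (g : bilinear_field (R := R) (M := G)) :
    Prop :=
  forall a b v w, tangent A b v -> tangent A b w ->
    g (a * b)%g (pushforward A (ltrans a) b v) (pushforward A (ltrans a) b w)
    = g b v w.

(* The Lie algebra of [G]. *)
Definition left_invariant_field (X : vfield R G) : Prop :=
  (forall b, smooth_field_at A b X) /\
  forall a b, X (a * b)%g = pushforward A (ltrans a) b (X b).

Fixpoint J_series (J : endo_field (R := R) (M := G)) (k : nat) :
    set (vfield R G) :=
  match k with
  | 0 => [set 0]
  | k'.+1 => [set X | left_invariant_field X /\
      forall Y, left_invariant_field Y ->
        J_series J k' (bracket A X Y) /\ J_series J k' (bracket A (appJ J X) Y)]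
  end.

Definition nilpotent_complex_structure (J : endo_field (R := R) (M := G)) :
    Prop :=
  exists k, left_invariant_field `<=` J_series J k.

End LieGroups.

Section NilpotentGroups.
Context {G : groupType}.

Fixpoint upper_central_series (k : nat) : set G :=
  match k with
  | 0 => [set 1%g]
  | k'.+1 => [set x | forall y, upper_central_series k' [~ x, y]%g]
  end.

Definition nilpotent_group : Prop :=
  exists k, upper_central_series k = setT.

End NilpotentGroups.
Arguments nilpotent_group : clear implicits.

Section UniversalCover.
Context {R : realType}.

Definition simply_connected (T : topologicalType) : Prop :=
  (forall x y : T, exists gam : R -> T,
     [/\ {within `[0, 1], continuous gam}, gam 0 = x & gam 1 = y]) /\
  (forall gam : R -> T, {within `[0, 1], continuous gam} -> gam 0 = gam 1 ->
   exists H : R * R -> T,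
     [/\ {within `[0, 1]%classic `*` `[0, 1]%classic, continuous H},
         forall t : R, 0 <= t <= 1 -> H (t, 0) = gam t,
         forall t : R, 0 <= t <= 1 -> H (t, 1) = gam 0 &
         forall s : R, 0 <= s <= 1 -> H (0, s) = gam 0 /\ H (1, s) = gam 0]).

Definition covering_map (E B : topologicalType) (prj : E -> B) : Prop :=
  [/\ continuous prj, (forall p, exists q, prj q = p) &
   forall p, exists U, [/\ open U, U p & exists S : set (set E),
     [/\ forall V, S V -> [/\ open V, set_bij V U prj &
           forall O, O `<=` V -> open O -> open (prj @` O)],
         trivIset S id & prj @^-1` U = \bigcup_(V in S) V]]].

Context {m : nat} {G M : topologicalType}.

Record universal_hermitian_cover
    (AG : set (chart R m G)) (JG : endo_field (R := R) (M := G))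
    (gG : bilinear_field (R := R) (M := G))
    (AM : set (chart R m M)) (JM : endo_field (R := R) (M := M))
    (gM : bilinear_field (R := R) (M := M)) (prj : G -> M) : Prop :=
  UniversalHermitianCover {
  uc_simply_connected : simply_connected G;
  uc_covering : covering_map prj;
  (* [prj], a local homeomorphism, is a local diffeomorphism *)
  uc_local_diffeo : forall q f,
    smooth_at AM (prj q) f <-> smooth_at AG q (f \o prj);
  uc_holomorphic : forall q v, tangent AG q v ->
    JM (prj q) (pushforward AM prj q v) = pushforward AM prj q (JG q v);
  uc_isometric : forall q v w, tangent AG q v -> tangent AG q w ->
    gM (prj q) (pushforward AM prj q v) (pushforward AM prj q w) = gG q v w }.

End UniversalCover.

(* Main.v *)
(* In a left-invariant frame the Strominger connection Gamma has constant
   coefficients, given by a Koszul-type formula.  Let b be the Lie bracket and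
   H(X) = R(X, JX, JX, X) the unnormalized curvature.  Since J is nilpotent,
     there
   is a nonzero J-invariant central subspace S; H vanishes on S, so f = 0.

   It remains to show that H >= 0 forces b = 0.  For e in S the expansion of
   H(e + t Y) starts with a term in t^2, which is thus nonnegative;
     but its trace
   over an orthonormal basis of vectors Y is a negative multiple of the sum of
   the |Gamma(Y, e)|^2, hence Gamma(Y,
     e) = 0.  If Q is the orthogonal projection
   onto S, then replacing b by (1 - Q) b changes H(X) to H(X) + |Q [X,
     JX]|^2 for
   X orthogonal to S; this is again nonnegative, and the ascending series of J
   gets shorter.  By induction (1 - Q) b = 0; the curvature of (1 - Q) b is then
   zero, hence Q [X, JX] = 0, and b = 0 follows by polarization.

   On M, the left-invariant frame pushed forward through local sections of the
   covering is now commuting and parallel, so the Strominger connection is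
   torsion free (hence M is Kaehler) and flat.  For the group,
     the right-invariant
   fields commute with the left-invariant frame, so their coefficients in it are
   constant: right- and left-invariant fields coincide, the map x |-> x^-1 a x
   has zero differential, and G is commutative. *)

Require Import Defs.
From HB Require Import structures.
From mathcomp Require Import all_boot all_order all_algebra.
From mathcomp Require Import all_classical all_reals all_analysis.
From mathcomp Require Import complex ring lra.

Set Implicit Arguments.
Unset Strict Implicit.
Unset Printing Implicit Defensive.

Import Order.TTheory GRing.Theory Num.Theory.
Import numFieldNormedType.Exports.

Local Open Scope classical_set_scope.
Local Open Scope ring_scope.

(** * Linear algebra of the Strominger connection *)

(** The inductive statement carries the sign [0 <= hol_curv] and not its vanishing: by
    [hol_curv_quotient], projecting the bracket adds a square to the curvature, so a zero is not
    inherited whereas a sign is. The same square is what finally forces the removed component of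
    [b x (J x)] to vanish.

    Everything is real. A (1,0)-vector is [x - i J x], so the sectional curvature becomes the
    quartic form [g (R x (J x) (J x)) x], and no unitary frame with triangular structure constants
    is chosen. For [u] in the central subspace, the two-form [g (b y z) u] splits by type into a
    (1,1)-part, seen by [G u y], and a (2,0)+(0,2)-part, seen by [G y u]. The trace argument removes
    the second part, the added square the first.

    Connections and curvature act on germs of fields, not on vectors. The algebra is therefore
    reached by evaluating on fields with constant coefficients in an invariant frame, and statements
    about arbitrary fields are recovered at the end by expanding them in that frame. *)

Record inner_product (R : realType) (m : nat)
    (g : 'rV[R]_m -> 'rV[R]_m -> R) : Prop := InnerProduct {
  ip_linear : forall a u v w, g (a *: u + v) w = a * g u w + g v w;
  ip_sym : forall u v, g u v = g v u;
  ip_gt0 : forall v, v <> 0 -> 0 < g v v }.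

Section InnerProduct.
Context {R : realType} {m : nat} (g : 'rV[R]_m -> 'rV[R]_m -> R).
Hypothesis gP : inner_product g.
Local Notation V := 'rV[R]_m.
Implicit Types (u v w : V) (a : R).

Lemma ip0l w : g 0 w = 0.
Proof.
have := ip_linear gP 1 0 0 w; rewrite scaler0 addr0 mul1r.
by move/eqP; rewrite eq_sym -subr_eq0 addrK => /eqP.
Qed.

Lemma ipDl u v w : g (u + v) w = g u w + g v w.
Proof. by rewrite -[u]scale1r (ip_linear gP) mul1r scale1r. Qed.

Lemma ipZl a u w : g (a *: u) w = a * g u w.
Proof. by rewrite -[_ *: _]addr0 (ip_linear gP) ip0l addr0. Qed.

Lemma ipNl u w : g (- u) w = - g u w.
Proof. by rewrite -scaleN1r ipZl mulN1r. Qed.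

Lemma ipBl u v w : g (u - v) w = g u w - g v w.
Proof. by rewrite ipDl ipNl. Qed.

Lemma ip0r w : g w 0 = 0.
Proof. by rewrite (ip_sym gP) ip0l. Qed.

Lemma ipDr u v w : g w (u + v) = g w u + g w v.
Proof. by rewrite (ip_sym gP) ipDl !(ip_sym gP w). Qed.

Lemma ipZr a u w : g w (a *: u) = a * g w u.
Proof. by rewrite (ip_sym gP) ipZl (ip_sym gP w). Qed.

Lemma ipNr u w : g w (- u) = - g w u.
Proof. by rewrite (ip_sym gP) ipNl (ip_sym gP w). Qed.

Lemma ip_suml k (x : 'I_k -> V) w : g (\sum_i x i) w = \sum_i g (x i) w.
Proof.
apply: (big_morph (fun u => g u w)) => [u v|]; [exact: ipDl|exact: ip0l].
Qed.

Lemma ip_ge0 u : 0 <= g u u.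
Proof.
by have [->|/eqP/(ip_gt0 gP)/ltW//] := eqVneq u 0; rewrite ip0l.
Qed.

Lemma ip_eq0 u : g u u = 0 -> u = 0.
Proof.
by have [//|/eqP/(ip_gt0 gP)] := eqVneq u 0; rewrite lt0r => /andP[/eqP].
Qed.

Lemma ip_inj u v : (forall w, g u w = g v w) -> u = v.
Proof.
move=> uv; apply/eqP; rewrite -subr_eq0; apply/eqP/ip_eq0.
by rewrite ipBl uv subrr.
Qed.

(** Indexing by [nat] lets a family be lengthened without changing its type; only the values below
    [k] count. *)
Definition orthonormal k (e : nat -> V) :=
  forall i j, (i < k)%N -> (j < k)%N -> g (e i) (e j) = (i == j)%:R.

Lemma orthonormal_size k e : orthonormal k e -> (k <= m)%N.
Proof.
move=> eP; pose A := \matrix_(i < k, j < m) e i 0 j.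
have rowA i : row i A = e i by apply/rowP => j; rewrite !mxE.
have mulA c : c *m A = \sum_i c 0 i *: e i.
  rewrite mulmx_sum_row; apply: eq_bigr => i _; by rewrite rowA.
suff /eqP <- : row_free A by exact: rank_leq_col.
rewrite -kermx_eq0; apply/eqP/row_matrixP => i; rewrite row0.
have := mulmx_ker A; move/(congr1 (row i)); rewrite row_mul row0 mulA.
set c := row i _ => /(congr1 g) cA.
apply/rowP => j; rewrite [RHS]mxE; have := congr1 (fun h => h (e j)) cA.
rewrite ip0l ip_suml (bigD1 j)//= ipZl eP// eqxx mulr1.
rewrite big1 ?addr0// => l lj.
by rewrite ipZl eP// (_ : _ == _ = false) ?mulr0//; apply/negbTE.
Qed.

(** An orthonormal family in [S] of the largest size spans it, since a nonzero remainder [s - t]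
    could be normalized and appended. It yields a basis for [S = setT] and an orthogonal projection
    for a proper subspace. *)
Lemma orthonormal_basis (S : set V) :
    S 0 -> (forall a u v, S u -> S v -> S (a *: u + v)) ->
  exists k (e : 'I_k -> V), [/\ forall i j, g (e i) (e j) = (i == j)%:R,
    forall i, S (e i) & forall s, S s -> s = \sum_i g s (e i) *: e i].
Proof.
move=> S0 SD.
pose P k := `[< exists e, orthonormal k e /\ forall i, (i < k)%N -> S (e i) >].
have exP : exists k, P k by exists 0%N; apply/asboolP; exists (fun=> 0); split.
have bndP k : P k -> (k <= m)%N.
  by move=> /asboolP[e [/orthonormal_size]].
case: (ex_maxnP exP bndP) => k /asboolP[e [eP eS]] kmax.
exists k, (fun i : 'I_k => e i); split=> [i j|i|s Ss].
- by rewrite eP//.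
- exact: eS.
set t := \sum_(i < k) _.
have St : S t.
  rewrite /t; elim/big_ind: _ => // [x y Sx Sy|i _].
    by rewrite -[x]scale1r; exact: SD.
  by rewrite -[_ *: _]addr0; apply: SD => //; exact: eS.
have gt j : (j < k)%N -> g (s - t) (e j) = 0.
  move=> jk; rewrite ipBl ip_suml (bigD1 (Ordinal jk))//= ipZl eP// eqxx mulr1.
  rewrite big1 ?addr0 ?subrr// => i ij.
  by rewrite ipZl eP// (_ : _ == _ = false) ?mulr0//; apply/negbTE.
apply/eqP; rewrite -subr_eq0; apply/negPn/negP => /eqP st0.
have gst := ip_gt0 gP st0.
pose c := (Num.sqrt (g (s - t) (s - t)))^-1.
have cK : c * (c * g (s - t) (s - t)) = 1.
  rewrite mulrA -expr2 exprVn sqr_sqrtr ?ltW// mulVf//.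
  by rewrite gt_eqF.
have /kmax : P k.+1; last by rewrite ltnn.
apply/asboolP; exists (fun i => if i == k then c *: (s - t) else e i); split.
  move=> i j; rewrite !ltnS => ik jk.
  have lt_k l : (l <= k)%N -> l != k -> (l < k)%N by rewrite ltn_neqAle =>
    -> ->.
  case: (eqVneq i k) => [ik'|/(lt_k _ ik) ik'];
    case: (eqVneq j k) => [jk'|/(lt_k _ jk) jk'].
  - by rewrite ipZl ipZr cK ik' jk' eqxx.
  - by rewrite ipZl gt// mulr0 ik' gtn_eqF.
  - by rewrite (ip_sym gP) ipZl gt// mulr0 jk' ltn_eqF.
  - exact: eP.
move=> i; rewrite ltnS => ik; have [_|ik'] := eqVneq i k.
  rewrite -[_ *: _]addr0; apply: (SD) => //.
  by rewrite -scaleN1r addrC; exact: SD.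
by apply: eS; rewrite ltn_neqAle ik'.
Qed.

End InnerProduct.

Record compatible_endo (R : realType) (m : nat)
    (g : 'rV[R]_m -> 'rV[R]_m -> R) (J : 'rV[R]_m -> 'rV[R]_m) : Prop :=
  CompatibleEndo {
  ce_linear : forall a u v, J (a *: u + v) = a *: J u + J v;
  ce_square : forall v, J (J v) = - v;
  ce_isometry : forall u v, g (J u) (J v) = g u v }.

(** These properties pass to the projected brackets of the induction; the last is the vanishing of
    the Nijenhuis tensor. *)
Record integrable_bracket (R : realType) (m : nat)
    (J : 'rV[R]_m -> 'rV[R]_m) (b : 'rV[R]_m -> 'rV[R]_m -> 'rV[R]_m) : Prop :=
  IntegrableBracket {
  ib_linear : forall a u v w, b (a *: u + v) w = a *: b u w + b v w;
  ib_skew : forall u v, b u v = - b v u;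
  ib_integrable : forall u v,
    b (J u) (J v) - J (b (J u) v) - J (b u (J v)) - b u v = 0 }.

Section CompatibleEndo.
Context {R : realType} {m : nat}.
Local Notation V := 'rV[R]_m.
Variables (g : V -> V -> R) (J : V -> V).
Hypothesis gP : inner_product g.
Hypothesis JP : compatible_endo g J.

Lemma ceD u v : J (u + v) = J u + J v.
Proof. by rewrite -[u]scale1r (ce_linear JP) !scale1r. Qed.

Lemma ce0 : J 0 = 0.
Proof.
by have /eqP := ceD 0 0; rewrite addr0 eq_sym -subr_eq0 addrK => /eqP.
Qed.

Lemma ceZ a u : J (a *: u) = a *: J u.
Proof. by rewrite -[_ *: _]addr0 (ce_linear JP) ce0 addr0. Qed.

Lemma ceN u : J (- u) = - J u.
Proof. by rewrite -scaleN1r ceZ scaleN1r. Qed.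

Lemma ce_adjoint u v : g (J u) v = - g u (J v).
Proof. by rewrite -(ce_isometry JP) (ce_square JP) (ipNl gP). Qed.

End CompatibleEndo.

Section IntegrableBracket.
Context {R : realType} {m : nat}.
Local Notation V := 'rV[R]_m.
Variables (J : V -> V) (b : V -> V -> V).
Hypothesis bP : integrable_bracket J b.

Lemma ibDl u v w : b (u + v) w = b u w + b v w.
Proof. by rewrite -[u]scale1r (ib_linear bP) !scale1r. Qed.

Lemma ib0l w : b 0 w = 0.
Proof.
by have /eqP := ibDl 0 0 w; rewrite addr0 eq_sym -subr_eq0 addrK => /eqP.
Qed.

Lemma ibZl a u w : b (a *: u) w = a *: b u w.
Proof. by rewrite -[_ *: _]addr0 (ib_linear bP) ib0l addr0. Qed.

Lemma ibNl u w : b (- u) w = - b u w.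
Proof. by rewrite -scaleN1r ibZl scaleN1r. Qed.

Lemma ibDr u v w : b w (u + v) = b w u + b w v.
Proof. by rewrite (ib_skew bP) ibDl opprD -!(ib_skew bP w). Qed.

Lemma ibZr a u w : b w (a *: u) = a *: b w u.
Proof. by rewrite (ib_skew bP) ibZl -scalerN -(ib_skew bP w). Qed.

Lemma ibNr u w : b w (- u) = - b w u.
Proof. by rewrite -scaleN1r ibZr scaleN1r. Qed.

End IntegrableBracket.

(** * The Strominger connection of a bracket and its curvature *)

Section Strominger.
Context {R : realType} {m : nat}.
Local Notation V := 'rV[R]_m.
Variables (g : V -> V -> R) (J : V -> V) (k : nat) (E : 'I_k -> V).
Variable b : V -> V -> V.

(* The value of [2 g(nabla_x y, z)] is the Koszul expression of the Levi-Civita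
   connection plus the torsion three-form
   [T x y z = - (g [Jx,Jy] z + g [Jy,Jz] x + g [Jz,Jx] y)]. *)
Definition strominger3 x y z : R :=
  2^-1 * (g (b x y) z - g (b y z) x + g (b z x) y
  - g (b (J x) (J y)) z - g (b (J y) (J z)) x - g (b (J z) (J x)) y).

(** The vector representing the linear form [strominger3 x y], once [E] expands every vector as an
    orthonormal basis does. *)
Definition strominger x y : V := \sum_i strominger3 x y (E i) *: E i.

(* [g (R x (J x) (J x)) x] for the curvature [R] of [strominger]. *)
Definition hol_curv x : R :=
  2 * g (J (strominger x x)) (strominger (J x) x)
  - g (J (strominger (b x (J x)) x)) x.

End Strominger.

Lemma leading_coef_ge0 (R : realType) (c2 c3 c4 : R) :
  (forall t, 0 <= t ^+ 2 * (c2 + t * c3 + t ^+ 2 * c4)) -> 0 <= c2.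
Proof.
move=> h; rewrite leNgt; apply/negP => c2lt0.
(* With [t * d = - c2] and [t <= 1], the bracketed factor is at most
   [c2 + t * (|c3| + |c4|) = t * c2 < 0]. Subtracting [c2] in [d] gives both [0 < d] and
   [t <= 1]. *)
pose d := `|c3| + `|c4| - c2; pose t := - c2 / d.
have d0 : 0 < d by rewrite /d; have := normr_ge0 c3; have := normr_ge0 c4; lra.
have t0 : 0 < t by rewrite divr_gt0// oppr_gt0.
have td : t * d = - c2 by rewrite divfK// gt_eqF.
have t1 : t <= 1.
  rewrite ler_pdivrMr// mul1r /d.
  by have := normr_ge0 c3; have := normr_ge0 c4; lra.
have := h t; rewrite pmulr_rge0 ?exprn_gt0//; apply/negP; rewrite -ltNge.
have h3 : t * c3 <= t * `|c3| by rewrite ler_pM2l// ler_norm.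
have h4 : t ^+ 2 * c4 <= t * `|c4|.
  apply: (@le_trans _ _ (t ^+ 2 * `|c4|)).
    by rewrite ler_pM2l ?exprn_gt0// ler_norm.
  by rewrite ler_wpM2r// expr2 ger_pMr.
have tc2 : t * c2 < 0 by rewrite pmulr_rlt0.
by move: td; rewrite /d !mulrDr mulrN; lra.
Qed.

Section StromingerAlgebra.
Context {R : realType} {m : nat}.
Local Notation V := 'rV[R]_m.
Variables (g : V -> V -> R) (J : V -> V).
Hypothesis gP : inner_product g.
Hypothesis JP : compatible_endo g J.
Variables (k : nat) (E : 'I_k -> V).
Hypothesis EP : forall x, x = \sum_i g x (E i) *: E i.

Let gC := ip_sym gP.
Let gsimp := (ipDl gP, ipDr gP, ipNl gP, ipNr gP, ipZl gP, ipZr gP).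
Let gJ := ce_adjoint gP JP.
Let JJ := ce_square JP.
Let Jsimp := (ceD JP, ceN JP, ceZ JP, JJ).

Lemma parseval u v : g u v = \sum_i g u (E i) * g v (E i).
Proof.
rewrite {1}[u]EP (ip_suml gP); apply: eq_bigr => i _.
by rewrite (ipZl gP) (gC v).
Qed.

Section Bracket.
Variable b : V -> V -> V.
Hypothesis bP : integrable_bracket J b.
Let bC := ib_skew bP.
Let bsimp := (ibDl bP, ibDr bP, ibNl bP, ibNr bP, ibZl bP, ibZr bP).

Local Notation G3 := (strominger3 g J b).
Local Notation G := (strominger g J E b).
Local Notation K := (hol_curv g J E b).

Lemma stromingerE x y z : g (G x y) z = G3 x y z.
Proof.
have G3l a u v : G3 x y (a *: u + v) = a * G3 x y u + G3 x y v.
  by rewrite /G3 !(Jsimp, bsimp, gsimp); field.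
have G30 : G3 x y 0 = 0.
  have /eqP := G3l 1 0 0; rewrite scaler0 addr0 mul1r.
  by rewrite eq_sym -subr_eq0 addrK => /eqP.
rewrite {2}[z]EP (ip_suml gP).
rewrite (big_morph (G3 x y) (id1 := 0) (op1 := +%R)) //=; last first.
  by move=> u v; have := G3l 1 u v; rewrite scale1r mul1r.
apply: eq_bigr => i _; have := G3l (g z (E i)) (E i) 0.
by rewrite addr0 G30 addr0 => ->; rewrite (ipZl gP) mulrC (gC (E i)).
Qed.

Lemma strominger_linearl a u v y : G (a *: u + v) y = a *: G u y + G v y.
Proof.
apply: (ip_inj gP) => z; rewrite !gsimp !stromingerE.
by rewrite /G3 !(Jsimp, bsimp, gsimp); field.
Qed.

Lemma strominger_linearr a u v y : G y (a *: u + v) = a *: G y u + G y v.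
Proof.
apply: (ip_inj gP) => z; rewrite !gsimp !stromingerE.
by rewrite /G3 !(Jsimp, bsimp, gsimp); field.
Qed.

Lemma strominger_metric x y z : g (G x y) z = - g y (G x z).
Proof.
rewrite [in RHS]gC !stromingerE /G3 (bC z y) (bC (J z) (J y)) (bC y x) (bC x z).
by rewrite (bC (J y) (J x)) (bC (J x) (J z)) !gsimp; field.
Qed.

Lemma strominger_J x y : G x (J y) = J (G x y).
Proof.
apply: (ip_inj gP) => z; rewrite gJ !stromingerE /G3.
have bJ u v : b (J u) (J v) = J (b (J u) v) + J (b u (J v)) + b u v.
  by apply/eqP; rewrite -subr_eq0 -(ib_integrable bP u v) !opprD !addrA.
(* Integrability paired with [w], one [J] being moved across [g]: it trades brackets with a single
   [J] for brackets with two or none. The pairs containing [x] suffice. *)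
have bJ' u v w : g (b (J u) v) w + g (b u (J v)) w =
    g (b (J u) (J v)) (J w) - g (b u v) (J w).
  by rewrite bJ !(gsimp, gJ, JJ); ring.
have := bJ' x y z; have := bJ' z x y.
rewrite !(Jsimp, bsimp, gsimp); lra.
Qed.


Let GD u v y : G (u + v) y = G u y + G v y.
Proof. by have := strominger_linearl 1 u v y; rewrite !scale1r. Qed.

Let G0 y : G 0 y = 0.
Proof.
by have /eqP := GD 0 0 y; rewrite addr0 eq_sym -subr_eq0 addrK => /eqP.
Qed.

Let GZ a u y : G (a *: u) y = a *: G u y.
Proof. by have := strominger_linearl a u 0 y; rewrite !addr0 G0 addr0. Qed.

Let GDr u v y : G y (u + v) = G y u + G y v.
Proof. by have := strominger_linearr 1 u v y; rewrite !scale1r. Qed.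

Let G0r y : G y 0 = 0.
Proof.
by have /eqP := GDr 0 0 y; rewrite addr0 eq_sym -subr_eq0 addrK => /eqP.
Qed.

Let GZr a u y : G y (a *: u) = a *: G y u.
Proof. by have := strominger_linearr a u 0 y; rewrite !addr0 G0r addr0. Qed.

Let GN u y : G (- u) y = - G u y.
Proof. by rewrite -scaleN1r GZ scaleN1r. Qed.

Let GNr u y : G y (- u) = - G y u.
Proof. by rewrite -scaleN1r GZr scaleN1r. Qed.

Let Gsimp := (GD, GZ, GN, GDr, GZr, GNr, strominger_J).

(* The torsion [t] of a Hermitian connection with totally skew torsion has no
   (3,0)-part, so it is determined by the bracket. *)
Lemma strominger3_unique (gam : V -> V -> V -> R) :
    (forall u w t, gam u w (- t) = - gam u w t) ->
    (forall u w t, gam u w t = - gam u t w) ->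
    (forall u w t, gam u (J w) t = - gam u w (J t)) ->
    (forall u w t, gam u w t - gam w u t - g (b u w) t
                 = - (gam u t w - gam t u w - g (b u t) w)) ->
  forall u w t, gam u w t = G3 u w t.
Proof.
move=> gamN gamC gamJ tor x y z.
pose T u w t := gam u w t - gam w u t - g (b u w) t.
have T12 u w t : T u w t = - T w u t by rewrite /T (bC u w) !gsimp; ring.
have T23 u w t : T u w t = - T u t w by exact: tor.
have Tc u w t : T u w t = T w t u by rewrite T12 T23 opprK.
(* Integrability excludes the (3,0)-part of the torsion, which is this identity once [T] is known to
   be alternating. *)
have T3 : T (J x) (J y) z + T (J y) (J z) x + T (J z) (J x) y = T x y z.
  have := congr1 (g^~ z) (ib_integrable bP x y).
  rewrite /= (ip0l gP) !(gsimp, gJ) -(Tc x (J y) (J z)) (Tc (J z) (J x) y) /T.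
  move: (gamJ (J x) y z) (gamJ (J y) x z) (gamJ y x (J z)) (gamJ x y (J z)).
  rewrite !JJ !gamN; lra.
(* In the cyclic sum the [gam] terms cancel in pairs, by skewness and compatibility with [J], so the
   torsion is expressed by the bracket alone. *)
have S3 : T (J x) (J y) z + T (J y) (J z) x + T (J z) (J x) y =
    - (g (b (J x) (J y)) z + g (b (J y) (J z)) x + g (b (J z) (J x)) y).
  rewrite /T.
  move: (gamJ (J x) y z) (gamJ (J y) z x) (gamJ (J z) x y).
  move: (gamC (J y) (J x) z) (gamC (J z) (J y) x) (gamC (J x) (J z) y).
  move: (gamC (J y) z (J x)) (gamC (J z) x (J y)) (gamC (J x) y (J z)).
  lra.
have := T3; rewrite S3 /G3 /strominger3 => eT.
have := tor x y z; have := tor y z x; have := tor z x y.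
move: (gamC x y z) (gamC y z x) (gamC z x y) eT.
rewrite /T (bC y x) (bC z y) (bC x z) !gsimp; lra.
Qed.

(** As metric and [J] are parallel, both second-order terms become [g (J (G x x)) (G (J x) x)],
    whence the factor 2 in [hol_curv]. *)
Lemma hol_curvE x :
  K x = g (G x (G (J x) (J x)) - G (J x) (G x (J x)) - G (b x (J x)) (J x)) x.
Proof.
rewrite /hol_curv !(ipBl gP) (strominger_metric (J x)) (strominger_metric x).
by rewrite !strominger_J (gJ (G (J x) x)) (gC _ (J (G x x))); ring.
Qed.

(** * Central directions *)

Section Vertical.
Variable S : set V.
Hypothesis SJ : forall u, S u -> S (J u).
Hypothesis Sb : forall u v, S u -> b u v = 0.

Let Sbr u v : S u -> b v u = 0.
Proof. by move=> Su; rewrite bC Sb ?oppr0. Qed.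

Lemma strominger_vertical_vertical u v : S u -> S v -> G u v = 0.
Proof.
move=> Su Sv; apply: (ip_inj gP) => z; rewrite stromingerE /strominger3.
have [SJu SJv] := (SJ Su, SJ Sv).
by rewrite !(Sb _ Su, Sbr _ Su, Sb _ Sv, Sbr _ Sv, Sb _ SJu, Sbr _ SJu,
  Sb _ SJv, Sbr _ SJv, ip0l gP) !subr0 !addr0 mulr0.
Qed.

(** As [u] and [J u] are central, only brackets of [y] with [z] survive: [G u y] gives minus the
    (1,1)-part of the form [g (b y z) u], and [G y u] below gives minus its (2,0)+(0,2)-part. *)
Lemma strominger_vertical3 u y z : S u ->
  g (G u y) z = - 2^-1 * (g (b y z) u + g (b (J y) (J z)) u).
Proof.
move=> Su; rewrite stromingerE /strominger3.
have SJu := SJ Su.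
rewrite !(Sb _ Su, Sbr _ Su, Sb _ SJu, Sbr _ SJu, ip0l gP); ring.
Qed.

Lemma strominger_horizontal3 u y z : S u ->
  g (G y u) z = - 2^-1 * (g (b y z) u - g (b (J y) (J z)) u).
Proof.
move=> Su; rewrite stromingerE /strominger3 (bC z) (bC (J z)).
have SJu := SJ Su.
rewrite !(Sb _ Su, Sbr _ Su, Sb _ SJu, Sbr _ SJu, ip0l gP) !gsimp; ring.
Qed.

(** Integrability paired with [J u]. Since [G y] commutes with [J] while [G^~ u] anticommutes with
    it, the two behave oppositely under [y |-> J y], which drives the averaging below. *)
Lemma strominger_horizontal_anti u y : S u -> G (J y) u = - J (G y u).
Proof.
move=> Su; rewrite -strominger_J; apply: (ip_inj gP) => z.
rewrite gsimp !strominger_horizontal3 ?Jsimp//; last exact: SJ.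
have := congr1 (g^~ (J u)) (ib_integrable bP y z).
by rewrite /= (ip0l gP) !(bsimp, gsimp, gJ, Jsimp); lra.
Qed.

Lemma hol_curv_vertical u : S u -> K u = 0.
Proof.
move=> Su; rewrite /hol_curv Sb// strominger_vertical_vertical// G0.
by rewrite (ce0 JP) !(ip0l gP) mulr0 subr0.
Qed.

Let C2 e y := 2 * g (J (G e y + G y e)) (G (J e) y + G (J y) e).

(** There are no terms of order 0 and 1 because [G e e] and [G (J e) e] vanish and [e] is central.
    The bracket term is itself of order 2, and [last0] delays its contribution to order 3, so [C2]
    contains only the quadratic term of [hol_curv]. *)
Lemma hol_curv_expand e y : S e -> exists c3 c4, forall t,
  K (e + t *: y) = t ^+ 2 * (C2 e y + t * c3 + t ^+ 2 * c4).
Proof.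
move=> Se; have SJe := SJ Se.
have Gee : G e e = 0 by exact: strominger_vertical_vertical.
have GJee : G (J e) e = 0 by exact: strominger_vertical_vertical.
have last0 v : g (J (G v e)) e = 0.
  by rewrite gJ strominger_horizontal3// !Jsimp !bsimp !Sbr// oppr0 !(ip0l
    gP); ring.
pose h := b y (J y).
exists (2 * (g (J (G e y + G y e)) (G (J y) y) + g (J (G y y)) (G (J e) y + G
  (J y) e))
  - g (J (G h e)) y - g (J (G h y)) e).
exists (2 * g (J (G y y)) (G (J y) y) - g (J (G h y)) y) => t.
rewrite /hol_curv /C2; set M := G (J e) y + _.
have -> : G (e + t *: y) (e + t *: y) = t *: (G e y + G y e) + t ^+ 2 *: G y y.
  by rewrite !Gsimp Gee; apply/rowP => i; rewrite !mxE; ring.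
have -> : G (J (e + t *: y)) (e + t *: y) = t *: M + t ^+ 2 *: G (J y) y.
  by rewrite /M !Jsimp !Gsimp GJee; apply/rowP => i; rewrite !mxE; ring.
have -> : b (e + t *: y) (J (e + t *: y)) = t ^+ 2 *: h.
  by rewrite /h !Jsimp !bsimp !(Sb _ Se, Sbr _ SJe) !(scaler0,
    add0r) scalerA -expr2.
rewrite !Gsimp !Jsimp !gsimp last0; ring.
Qed.

Lemma strominger_horizontal_vertical : (forall x, 0 <= K x) ->
  forall e y, S e -> G y e = 0.
Proof.
move=> K0 e y Se; have SJe := SJ Se.
have C20 z : 0 <= C2 e z.
  have [c3 [c4 h]] := hol_curv_expand z Se.
  by apply: (@leading_coef_ge0 _ _ c3 c4) => t; rewrite -h.
(* Passing to [J z] multiplies [G e z] by [J] and [G z e] by [- J], so the mixed products cancel in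
   the sum and only two terms remain: one with zero trace, and a negative square. *)
have C2J z : C2 e z + C2 e (J z) =
    4 * (g (J (G e z)) (G (J e) z) - g (G z e) (G z e)).
  rewrite /C2 !(strominger_horizontal_anti _ Se) !strominger_J !Jsimp !gsimp.
  by rewrite !gJ !Jsimp !gsimp !(gC (G z e)); ring.
(* [J \o G e] is symmetric and [G (J e)] is skew *)
have tr0 : \sum_i g (J (G e (E i))) (G (J e) (E i)) = 0.
  set s := \sum_i _; have sE : s = - s.
    rewrite /s; under eq_bigr do rewrite parseval.
    rewrite {1}exchange_big -sumrN /=; apply: eq_bigr => i _.
    rewrite -sumrN; apply: eq_bigr => j _.
    rewrite (strominger_metric (J e)) (gC (E j) (G _ _)) mulrN;
      congr (- (_ * _)).
    by rewrite gJ strominger_metric opprK strominger_J gC.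
  by move: sE; lra.
have sum0 : \sum_i g (G (E i) e) (G (E i) e) <= 0.
  have : 0 <= \sum_i (C2 e (E i) + C2 e (J (E i))).
    by apply: sumr_ge0 => i _; rewrite addr_ge0.
  under eq_bigr do rewrite C2J.
  by rewrite -mulr_sumr sumrB tr0 sub0r pmulr_rge0// oppr_ge0.
have GE i : G (E i) e = 0.
  apply: (ip_eq0 gP); apply/eqP; rewrite eq_le ip_ge0// andbT.
  apply: le_trans sum0; rewrite (bigD1 i)//= lerDl sumr_ge0// => j _.
  exact: ip_ge0.
rewrite [y]EP (big_morph (G^~ e) (id1 := 0) (op1 := +%R))//.
by apply: big1 => i _; rewrite GZ GE scaler0.
Qed.

End Vertical.
End Bracket.

(** * Projecting the bracket away from a central subspace *)

Section Quotient.
Variable b : V -> V -> V.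
Hypothesis bP : integrable_bracket J b.
Variable S : set V.
Hypothesis SJ : forall u, S u -> S (J u).
Hypothesis Sb : forall u v, S u -> b u v = 0.
Variable Q : V -> V.
Hypothesis Q_linear : forall a u v, Q (a *: u + v) = a *: Q u + Q v.
Hypothesis QS : forall u, S (Q u).
Hypothesis Q_id : forall u, S u -> Q u = u.
Hypothesis Q_sym : forall u v, g (Q u) v = g u (Q v).
Hypothesis K0 : forall x, 0 <= hol_curv g J E b x.

Let S0 : S 0.
Proof.
suff : Q 0 = 0 by move=> <-; exact: QS.
have /eqP := Q_linear 1 0 0.
by rewrite !scale1r addr0 eq_sym -subr_eq0 addrK => /eqP.
Qed.

Let QD u v : Q (u + v) = Q u + Q v.
Proof. by have := Q_linear 1 u v; rewrite !scale1r. Qed.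

Let QZ a u : Q (a *: u) = a *: Q u.
Proof. by have := Q_linear a u 0; rewrite addr0 (Q_id S0) addr0. Qed.

Let QN u : Q (- u) = - Q u.
Proof. by rewrite -scaleN1r QZ scaleN1r. Qed.

Let SD a u v : S u -> S v -> S (a *: u + v).
Proof. by move=> /Q_id <- /Q_id <-; rewrite -Q_linear; exact: QS. Qed.

Let QQ u : Q (Q u) = Q u.
Proof. exact: Q_id. Qed.

(** [J] is skew and preserves [S], hence also preserves the orthogonal complement of [S]. *)
Let QJ u : Q (J u) = J (Q u).
Proof.
suff /eqP : Q (J (u - Q u)) = 0.
  rewrite (ceD JP) (ceN JP) QD QN subr_eq0 => /eqP ->.
  by rewrite Q_id//; exact: SJ.
apply: (ip_inj gP) => w; rewrite (ip0l gP) Q_sym gJ.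
rewrite -(Q_id (SJ (QS w))) -Q_sym QD QN QQ subrr.
by rewrite (ip0l gP) oppr0.
Qed.

(** The quotient by [S] realized on all of [V]: the complement of [S] carries it and [S] becomes a
    flat factor, so the induction never changes the dimension. *)
Definition quotient_bracket u v := b u v - Q (b u v).
Local Notation b' := quotient_bracket.

Let bC := ib_skew bP.

Lemma quotient_bracket_integrable : integrable_bracket J b'.
Proof.
split=> [a u v w|u v|u v]; rewrite /b'.
- by rewrite (ib_linear bP) Q_linear; apply/rowP => i; rewrite !mxE; ring.
- by rewrite bC QN; apply/rowP => i; rewrite !mxE; ring.
have := congr1 (fun w => w - Q w) (ib_integrable bP u v).
rewrite (Q_id S0) subrr !(QD, QN, ceD JP, ceN JP, QJ) => h.
by rewrite -[RHS]h; apply/rowP => i; rewrite !mxE; ring.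
Qed.
Let bP' := quotient_bracket_integrable.

Let Sb' u v : S u -> b' u v = 0.
Proof. by move=> Su; rewrite /b' Sb// (Q_id S0) subrr. Qed.

Let gb' u x y : S u -> g (b' x y) u = 0.
Proof. by move=> Su; rewrite /b' (ipBl gP) Q_sym Q_id// subrr. Qed.

Local Notation G := (strominger g J E b).
Local Notation G' := (strominger g J E b').

Let G'l u y : S u -> G' u y = 0.
Proof.
move=> Su; apply: (ip_inj gP) => z.
rewrite (strominger_vertical3 bP' SJ Sb')// !gb'// (ip0l gP); ring.
Qed.

Let G'r u y : S u -> G' y u = 0.
Proof.
move=> Su; apply: (ip_inj gP) => z.
rewrite (strominger_horizontal3 bP' SJ Sb')// !gb'// (ip0l gP); ring.
Qed.

Let Gr u y : S u -> G y u = 0.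
Proof. exact: strominger_horizontal_vertical. Qed.

(** Both sides are orthogonal to [S]: by metricity their components there are governed by
    [G x (Q z)] and [G' x (Q z)], which vanish, the former by the trace argument. Against vectors
    orthogonal to [S] the projection of the bracket is invisible. *)
Let G'E x y : Q x = 0 -> Q y = 0 -> G' x y = G x y.
Proof.
move=> Qx Qy; apply: (ip_inj gP) => z.
have -> : z = (z - Q z) + Q z by rewrite subrK.
rewrite !(ipDr gP (z - Q z)) (strominger_metric bP _ _ (Q z)) (Gr x (QS z))
  (ip0r gP) oppr0.
rewrite (strominger_metric bP' _ _ (Q z)) (G'r x (QS z)) (ip0r gP) oppr0 !addr0.
set w := z - Q z.
have Qw : Q w = 0 by rewrite QD QN QQ subrr.
have gbw u v t : Q t = 0 -> g (b' u v) t = g (b u v) t.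
  by move=> Qt; rewrite /b' (ipBl gP) Q_sym Qt (ip0r gP) subr0.
by rewrite !stromingerE// /strominger3 !gbw.
Qed.

(** An analogue of O'Neill's formula. Only the bracket term changes, by [g (J (G v x)) x] with
    [v = Q (b x (J x))]; [strominger_vertical3] evaluates this to [g v v], both halves of the
    (1,1)-part being equal. *)
Lemma hol_curv_quotient x : Q x = 0 ->
  hol_curv g J E b' x
  = hol_curv g J E b x + g (Q (b x (J x))) (Q (b x (J x))).
Proof.
move=> Qx; have QJx : Q (J x) = 0 by rewrite QJ Qx (ce0 JP).
rewrite /hol_curv !G'E//; last by rewrite /b' QD QN QQ subrr.
set v := Q (b x (J x)).
have := strominger_linearl bP (-1) v (b x (J x)) x.
rewrite !scaleN1r [- v + _]addrC -/(b' _ _) => ->.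
rewrite (ceD JP) (ceN JP) (ipDl gP) (ipNl gP) (gJ (G v x)).
rewrite (strominger_vertical3 bP SJ Sb); last exact: QS.
rewrite JJ (ibNr bP) (bC (J x)) !opprK.
have -> : g (b x (J x)) v = g v v by rewrite -{1}[v]QQ -Q_sym.
by field.
Qed.

(** [S] is a flat factor for the projected bracket, so the component [Q x] may be dropped and the
    preceding formula applies. *)
Lemma hol_curv_quotient_ge0 x : 0 <= hol_curv g J E b' x.
Proof.
have xE : x = (x - Q x) + Q x by rewrite subrK.
set y := x - Q x in xE; have Qy : Q y = 0 by rewrite QD QN QQ subrr.
suff -> : hol_curv g J E b' x = hol_curv g J E b' y.
  by rewrite hol_curv_quotient// addr_ge0// ip_ge0.
have G'y u v : G' (u + Q x) (v + Q x) = G' u v.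
  have := strominger_linearl bP' 1 u (Q x) (v + Q x).
  have := strominger_linearr bP' 1 v (Q x) u.
  by rewrite !scale1r => -> ->; rewrite (G'r u (QS x)) (G'l _ (QS x)) !addr0.
have G'Jy v : G' (J (y + Q x)) (v + Q x) = G' (J y) v.
  have := strominger_linearl bP' 1 (J y) (J (Q x)) (v + Q x).
  have := strominger_linearr bP' 1 v (Q x) (J y).
  rewrite (ceD JP) !scale1r => -> ->.
  by rewrite (G'r _ (QS x)) (G'l _ (SJ (QS x))) !addr0.
have G'br u v : G' u (v + Q x) = G' u v.
  have := strominger_linearr bP' 1 v (Q x) u.
  by rewrite !scale1r => ->; rewrite (G'r u (QS x)) addr0.
have b'x : b' (y + Q x) (J (y + Q x)) = b' y (J y).
  rewrite (ibDl bP') (Sb' _ (QS x)) addr0 (ceD JP) (ibDr bP').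
  by rewrite (ib_skew bP' y (J (Q x))) (Sb' _ (SJ (QS x))) oppr0 addr0.
rewrite xE /hol_curv G'y G'Jy b'x G'br (ipDr gP).
rewrite [X in _ - (_ + X)]gJ (strominger_metric bP').
by rewrite (G'r _ (SJ (QS x))) (ip0r gP) !oppr0 addr0.
Qed.

Lemma quotient_bracket_abelian :
  (forall u v, b' u v = 0) -> forall u v, b u v = 0.
Proof.
move=> b'0; have bQ u v : Q (b u v) = b u v.
  by apply/eqP; rewrite eq_sym -subr_eq0; apply/eqP/b'0.
have G'0 u v : G' u v = 0.
  apply: (ip_inj gP) => z; rewrite stromingerE// /strominger3 !b'0.
  by rewrite !(ip0l gP) !subr0 !addr0 mulr0.
have bJ0 x : Q x = 0 -> b x (J x) = 0.
  move=> Qx; have := hol_curv_quotient Qx.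
  rewrite /hol_curv !G'0 (ce0 JP) !(ip0l gP) mulr0 subr0 bQ -/(hol_curv g J E
    b x).
  move=> /esym h; apply: (ip_eq0 gP).
  have := ip_ge0 gP (b x (J x)); have := K0 x; lra.
have bJ x : b x (J x) = 0.
  have xE : x = (x - Q x) + Q x by rewrite subrK.
  set y := x - Q x in xE; have Qy : Q y = 0 by rewrite QD QN QQ subrr.
  rewrite xE (ibDl bP) (Sb _ (QS x)) addr0 (ceD JP) (ibDr bP).
  by rewrite (bC y (J (Q x))) (Sb _ (SJ (QS x))) oppr0 addr0; exact: bJ0.
(* All brackets lie in [S], and the vanishing of [G u (Q w)] says that they have no
   (2,0)+(0,2)-part. *)
have bJJ u v : b (J u) (J v) = b u v.
  apply: (ip_inj gP) => w; rewrite -(bQ u) -(bQ (J u)) !Q_sym.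
  have := strominger_horizontal3 bP SJ Sb u v (QS w).
  by rewrite Gr// (ip0l gP); lra.
(* The two cross terms, [b u (J (J v))] and [b (J v) (J u)], both equal [- b u v]. *)
move=> u v; have := bJ (u + J v).
rewrite (ceD JP) !(ibDl bP, ibDr bP) !bJ JJ add0r addr0 (bC (J v)) bJJ.
rewrite (ibNr bP) -opprD => /eqP; rewrite oppr_eq0 -mulr2n => /eqP h.
by apply/rowP => i; have := congr1 (fun A : V => A 0 i) h; rewrite !mxE; lra.
Qed.

End Quotient.

(** The closure properties of the ascending series that the induction uses. Carrying these alone
    avoids identifying the shifted flag with the series of the projected bracket. *)
Definition J_flag (b : V -> V -> V) (F : nat -> set V) (k : nat) :=
  [/\ forall u, F 0%N u -> u = 0,
      forall j, F j 0 /\ forall a u v, F j u -> F j v -> F j (a *: u + v),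
      forall j u, F j u -> F j (J u) /\ F j.+1 u,
      forall j u v, F j.+1 u -> F j (b u v) & forall u, F k u].

Theorem nilpotent_hol_curv_ge0_abelian k' (F : nat -> set V) b :
    integrable_bracket J b -> J_flag b F k' ->
  (forall x, 0 <= hol_curv g J E b x) -> forall u v, b u v = 0.
Proof.
elim: k' F b => [|k' IH] F b bP [F0 FD FJ Fb FT] K0 u v; first exact: F0.
have F1b x y : F 1%N x -> b x y = 0 by move=> Fx; apply/F0/Fb.
case: k' => [|k'] in IH FT; first exact: F1b.
have [[F10 F1D] F1J] := (FD 1%N, fun x Fx => proj1 (FJ 1%N x Fx)).
have [l [e [_ eF eE]]] := orthonormal_basis gP F10 F1D.
pose Q x := \sum_i g x (e i) *: e i.
have Q_linear a x y : Q (a *: x + y) = a *: Q x + Q y.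
  rewrite /Q scaler_sumr -big_split; apply: eq_bigr => i _ /=.
  by rewrite (ip_linear gP) scalerDl scalerA.
have QF x : F 1%N (Q x).
  rewrite /Q; elim/big_rec: _ => // i y _; exact: F1D.
have Q_id x : F 1%N x -> Q x = x by move=> /eE.
have Q_sym x y : g (Q x) y = g x (Q y).
  rewrite (gC x) /Q !(ip_suml gP); apply: eq_bigr => i _.
  by rewrite !(ipZl gP) mulrC (gC y) (gC (e i) x).
have bP' := quotient_bracket_integrable bP F1J Q_linear QF Q_id Q_sym.
apply: (quotient_bracket_abelian bP F1J F1b Q_linear QF Q_id Q_sym K0).
(* The term [F 1] is skipped. The projected bracket sends [F 2] to 0 because [Q] fixes [F 1]; at
   higher levels subtracting a vector of [F 1] stays inside the flag. *)
pose F' j := if j is j'.+1 then F j'.+2 else F 0%N.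
apply: (IH F') => //; last first.
  by move=> x; apply: (hol_curv_quotient_ge0 bP F1J F1b Q_linear QF Q_id Q_sym
    K0).
have F1s j x : F 1%N x -> F j.+1 x.
  by elim: j => // j IHj /IHj /FJ[].
split=> [//|[|j]|[|j] x|[|j] x y|//] /=; [exact: FD|exact: FD| |exact: FJ| |].
- by move=> Fx; split; [exact: (FJ _ _ Fx).1|apply: (FJ _ _ _).2;
  exact: (FJ _ _ Fx).2].
- by move=> /Fb-/(_ y) /Q_id bE; rewrite /quotient_bracket bE subrr;
  exact: (FD 0%N).1.
- move=> /Fb-/(_ y) Fxy; rewrite /quotient_bracket addrC -scaleN1r.
  by apply: (FD _).2 => //; exact: F1s.
Qed.

(** The first nonzero term of the flag is central, because brackets with it fall into a zero term.
    It is found by minimality since a flag may repeat its zero term. *)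
Lemma hol_curv_flat_vector k' (F : nat -> set V) b (v : V) :
    integrable_bracket J b -> J_flag b F k' -> v <> 0 ->
  exists2 e, e <> 0 & hol_curv g J E b e = 0.
Proof.
move=> bP [F0 FD FJ Fb FT] v0.
have exF : exists j, `[< exists2 u, F j u & u <> 0 >].
  by exists k'; apply/asboolP; exists v.
case: (ex_minnP exF) => -[|j] /asboolP[e Fe e0] jmin; first by have := F0 _ Fe.
exists e => //; apply: (hol_curv_vertical bP (S := F j.+1)) => // [|u w Fu].
  by move=> u /FJ[].
apply: contrapT => buw0; suff : (j.+1 <= j)%N by rewrite ltnn.
by apply: jmin; apply/asboolP; exists (b u w) => //; exact: Fb.
Qed.

End StromingerAlgebra.

(** * Smooth functions on open subsets of a coordinate space *)

Lemma near0_differentiable (R : realType) (V W : normedModType R) (h : V -> W)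
  x :
  (\near x, h x = 0) -> differentiable h x.
Proof.
move=> h0; have hx : h x = 0 by exact: nbhs_singleton h0.
have ho : h \o shift x = cst (h x) + (\0 : V -> W) +o_ 0 id.
  apply/eqaddoP => _/posnumP[e]; near=> y.
  rewrite !fctE /= hx addr0 subr0.
  suff -> : h (y + x) = 0 by rewrite normr0 mulr_ge0.
  near: y; move: h0; rewrite (near_shift 0 x)/=.
  by apply: filterS => y /=; rewrite subr0.
have h'0 : 'd h x = \0 :> (V -> W).
  by apply: diff_unique => //; exact: cst_continuous.
by apply/diff_locallyP; split; rewrite h'0//; exact: cst_continuous.
Unshelve. all: by end_near. Qed.

Lemma near_eq_differentiable (R : realType) (V W : normedModType R)
    (f g : V -> W) x :
  (\near x, f x = g x) -> differentiable f x -> differentiable g x.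
Proof.
move=> fg df; have -> : g = f + (g - f) by apply/funext => y;
  rewrite !fctE addrC subrK.
apply: differentiableD => //; apply: near0_differentiable.
by move: fg; apply: filterS => y fgy; rewrite !fctE fgy subrr.
Qed.

Section Rows.
Context {R : realType} {m : nat}.

Lemma row_deltaE (a : 'rV[R]_m) : a = \sum_j a 0 j *: delta_mx 0 j.
Proof. by rewrite {1}[a]row_sum_delta. Qed.

Lemma differentiable_row (V : normedModType R) (f : V -> 'rV[R]_m) x :
  (forall j, differentiable (fun y => f y 0 j) x) -> differentiable f x.
Proof.
move=> df; have -> : f = \sum_j (fun y => f y 0 j *: delta_mx 0 j).
  by apply/funext => y; rewrite fct_sumE -row_deltaE.
by apply: differentiable_sum => j; exact: differentiableZl.
Qed.

Lemma derive_row (V : normedModType R) (f : V -> 'rV[R]_m) x v j :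
  differentiable f x -> ('D_v f x) 0 j = 'D_v (fun y => f y 0 j) x.
Proof. by move=> df; rewrite derive_mx ?mxE//; exact: diff_derivable. Qed.

Lemma derive_sum_delta (W : normedModType R) (f : 'rV[R]_m -> W) x v :
  differentiable f x ->
  'D_v f x = \sum_j v 0 j *: 'D_(delta_mx 0 j) f x.
Proof.
move=> df; rewrite deriveE// {1}[v]row_deltaE linear_sum.
by apply: eq_bigr => j _; rewrite linearZ /= deriveE.
Qed.

End Rows.

Lemma derive_comp (R : realType) (U V W : normedModType R) (f : V -> W)
    (h : U -> V) x v :
  differentiable h x -> differentiable f (h x) ->
  'D_v (f \o h) x = 'D_('D_v h x) f (h x).
Proof.
move=> dh df; rewrite (deriveE _ (differentiable_comp dh df)) diff_comp//=.
by rewrite (deriveE _ dh) (deriveE _ df).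
Qed.

Section Ck.
Context {R : realType} {m : nat}.
Implicit Types (V : set 'rV[R]_m) (f h : 'rV[R]_m -> R).

Lemma near_open V (P : set 'rV[R]_m) x :
  open V -> V x -> V `<=` P -> nbhs x P.
Proof.
by move=> oV Vx VP; apply: filterS VP _; exact: open_nbhs_nbhs.
Qed.

Lemma Ck_eq k V f h : open V -> (forall x, V x -> f x = h x) ->
  Ck k V f -> Ck k V h.
Proof.
move=> oV; elim: k f h => [|k IH] f h fh /=.
  move=> cf x Vx; have := cf _ Vx; rewrite /prop_for /continuous_at fh//.
  apply: cvg_trans; apply: (@near_eq_cvg _ _ (nbhs x)).
  by apply: (near_open oV Vx) => y /fh.
move=> [df cf]; split=> [x Vx|i].
  by apply: near_eq_differentiable (df _ Vx); exact: (near_open oV Vx fh).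
apply: IH (cf i) => x Vx.
by apply: near_eq_derive; exact: (near_open oV Vx fh).
Qed.

Lemma CkW k V f : Ck k.+1 V f -> Ck k V f.
Proof.
elim: k f => [|k IH] f /= [df cf]; last by split=> // i; exact: IH.
by move=> x Vx; exact/differentiable_continuous/df.
Qed.

Lemma Ck_sub k V V' f : V' `<=` V -> Ck k V f -> Ck k V' f.
Proof.
move=> VV'; elim: k f => [|k IH] f /=; first by move=> cf x /VV'; exact: cf.
by move=> [df cf]; split=> [x /VV'|i]; [exact: df|exact: IH].
Qed.

Lemma Ck_cst k V (c : R) : open V -> Ck k V (cst c).
Proof.
move=> oV; elim: k c => [|k IH] c /=; first by move=> x _;
  exact: cst_continuous.
split=> [x _|i]; first exact: differentiable_cst.
apply: Ck_eq (IH 0) => // x _; by rewrite derive_cst.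
Qed.

Lemma CkD k V f h : open V -> Ck k V f -> Ck k V h -> Ck k V (f + h).
Proof.
move=> oV; elim: k f h => [|k IH] f h /=.
  by move=> cf ch x Vx; apply: continuousD; [exact: cf|exact: ch].
move=> [df cf] [dh ch]; split=> [x Vx|i].
  by apply: differentiableD; [exact: df|exact: dh].
apply: Ck_eq (IH _ _ (cf i) (ch i)) => // x Vx.
by rewrite fctE deriveD//; apply: diff_derivable; auto.
Qed.

Lemma CkM k V f h : open V -> Ck k V f -> Ck k V h -> Ck k V (f * h).
Proof.
move=> oV; elim: k f h => [|k IH] f h.
  by move=> cf ch x Vx; apply: continuousM; [exact: cf|exact: ch].
move=> cf' ch'; have [df cf] := cf'; have [dh ch] := ch'; split=> [x Vx|i].
  by apply: differentiableM; [exact: df|exact: dh].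
have := CkD oV (IH _ _ (CkW cf') (ch i)) (IH _ _ (CkW ch') (cf i)).
apply: Ck_eq => // x Vx.
by rewrite fctE deriveM//; apply: diff_derivable; auto.
Qed.

Lemma Ck_sum k V n (f : 'I_n -> 'rV[R]_m -> R) : open V ->
  (forall i, Ck k V (f i)) -> Ck k V (\sum_i f i).
Proof.
move=> oV cf; elim/big_ind: _ => // [|u v]; first exact: Ck_cst.
exact: CkD.
Qed.

Lemma Ck_coord k V j : open V -> Ck k V (fun x => x 0 j).
Proof.
move=> oV; have dc (x : 'rV[R]_m) : differentiable (fun x : 'rV[R]_m =>
  x 0 j) x.
  exact: differentiable_coord.
case: k => [|k] /=.
  by move=> x _; exact/differentiable_continuous.
split=> [x _ //|i]; apply: Ck_eq (Ck_cst k (delta_mx 0 i 0 j) oV) => // x _.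
by rewrite /cst -derive_row ?derive_id//.
Qed.

End Ck.

(** Chain rule and induction on [k]. The extra degree on [h] gives its continuity when [k = 0] and
    keeps its partial derivatives regular enough in the step; for smooth germs the loss of one
    degree is harmless. *)
Lemma Ck_comp (R : realType) (m n k : nat) (V : set 'rV[R]_m) (W : set 'rV[R]_n)
    (h : 'rV[R]_m -> 'rV[R]_n) (f : 'rV[R]_n -> R) :
  open V -> open W -> (forall x, V x -> W (h x)) ->
  (forall j, Ck k.+1 V (fun x => h x 0 j)) -> Ck k W f -> Ck k V (f \o h).
Proof.
move=> oV oW hVW; elim: k f => [|k IH] f ch cf.
  move=> x Vx; apply: continuous_comp; last exact/cf/hVW.
  apply/differentiable_continuous/differentiable_row => j.
  by have [+ _] := ch j; exact.
have dh x : V x -> differentiable h x.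
  by move=> Vx; apply: differentiable_row => j; have [+ _] := ch j; exact.
have [df cf'] := cf; split=> [x Vx|i].
  by apply: differentiable_comp; [exact: dh|exact/df/hVW].
have : Ck k V (\sum_j ((fun x => 'D_(delta_mx 0 i) (fun y => h y 0 j) x) *
                       ('D_(delta_mx 0 j) f \o h))).
  apply: Ck_sum => // j; apply: CkM => //.
    by apply: CkW; have [_ +] := ch j; exact.
  by apply: IH => [l|]; [exact/CkW|exact: cf'].
apply: Ck_eq => // x Vx; rewrite derive_comp//; [|exact: dh|exact/df/hVW].
rewrite derive_sum_delta; last exact/df/hVW.
by rewrite fct_sumE; apply: eq_bigr => j _; rewrite derive_row//; exact: dh.
Qed.

Section SmoothGerms.
Context {R : realType} {m : nat}.
Implicit Types (f h : 'rV[R]_m -> R) (x : 'rV[R]_m).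

Lemma smooth_germ_eq x f h : (\near x, f x = h x) ->
  smooth_germ x f -> smooth_germ x h.
Proof.
move=> fh [V [oV Vx cf]]; pose U : set 'rV[R]_m := [set y | f y = h y]°.
have oU : open U by exact: open_interior.
have Ufh y : U y -> f y = h y by move=> /interior_subset.
exists (U `&` V); split=> [|//|k]; first exact: openI.
apply: (@Ck_eq _ _ _ _ f); first exact: openI.
  by move=> y [/Ufh].
by apply: Ck_sub (cf k) => y [].
Qed.

Lemma smooth_germ_near x f : smooth_germ x f -> \near x, smooth_germ x f.
Proof. by move=> [V [oV Vx cf]]; apply: (near_open oV Vx) => y Vy;
  exists V. Qed.

Lemma smooth_germ_differentiable x f : smooth_germ x f -> differentiable f x.
Proof. by move=> [V [oV Vx /(_ 1%N)[df _]]]; exact: df. Qed.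

Lemma smooth_germD x f h :
  smooth_germ x f -> smooth_germ x h -> smooth_germ x (f + h).
Proof.
move=> [U [oU Ux cf]] [V [oV Vx ch]]; exists (U `&` V); split=> [|//|k].
  exact: openI.
apply: CkD; [exact: openI|apply: Ck_sub (cf k)|apply: Ck_sub (ch k)].
all: by move=> ? [].
Qed.

Lemma smooth_germM x f h :
  smooth_germ x f -> smooth_germ x h -> smooth_germ x (f * h).
Proof.
move=> [U [oU Ux cf]] [V [oV Vx ch]]; exists (U `&` V); split=> [|//|k].
  exact: openI.
apply: CkM; [exact: openI|apply: Ck_sub (cf k)|apply: Ck_sub (ch k)].
all: by move=> ? [].
Qed.

Lemma smooth_germ_cst x (c : R) : smooth_germ x (cst c).
Proof. by exists setT; split=> [|//|k]; [exact: openT|exact/Ck_cst/openT]. Qed.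

Lemma smooth_germ_coord x j : smooth_germ x (fun y => y 0 j).
Proof. by exists setT; split=> [|//|k];
  [exact: openT|exact/Ck_coord/openT]. Qed.

Lemma smooth_germ_derive_delta x f i :
  smooth_germ x f -> smooth_germ x (fun y => 'D_(delta_mx 0 i) f y).
Proof.
by move=> [V [oV Vx cf]]; exists V; split=> // k; have [_] := cf k.+1; exact.
Qed.

Lemma smooth_germ_sum x n (f : 'I_n -> 'rV[R]_m -> R) :
  (forall i, smooth_germ x (f i)) -> smooth_germ x (\sum_i f i).
Proof.
move=> cf; elim/big_ind: _ => // [|u v]; first exact: smooth_germ_cst.
exact: smooth_germD.
Qed.

Lemma smooth_germ_derive x f v :
  smooth_germ x f -> smooth_germ x (fun y => 'D_v f y).
Proof.
move=> sf; apply: (@smooth_germ_eq _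
  (\sum_j (cst (v 0 j) * (fun y => 'D_(delta_mx 0 j) f y)))); last first.
  apply: smooth_germ_sum => j; apply: smooth_germM.
    exact: smooth_germ_cst.
  exact: smooth_germ_derive_delta.
move: (smooth_germ_near sf); apply: filterS => y /smooth_germ_differentiable df.
by rewrite derive_sum_delta// fct_sumE.
Qed.

End SmoothGerms.

Lemma smooth_germ_comp (R : realType) (m n : nat) (h : 'rV[R]_m -> 'rV[R]_n)
    (f : 'rV[R]_n -> R) x :
  (forall j, smooth_germ x (fun y => h y 0 j)) -> smooth_germ (h x) f ->
  smooth_germ x (f \o h).
Proof.
move=> sh [W [oW Wx cf]].
have dh : differentiable h x.
  by apply: differentiable_row => j; exact: smooth_germ_differentiable.
have /choice[U UP] j := sh j.
pose V : set 'rV[R]_m := ([set y | forall j, U j y] `&` h @^-1` W)°.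
have VU : V `<=` [set y | forall j,
  U j y] `&` h @^-1` W by exact: interior_subset.
have oV : open V by exact: open_interior.
exists V; split=> [//||k].
  apply: filterI; last first.
    by apply: (differentiable_continuous dh); exact: open_nbhs_nbhs.
  by apply: (@filter_forall _ _ U (nbhs x)) => j; have [oU Ux _] := UP j;
    exact: open_nbhs_nbhs.
apply: (Ck_comp oV oW _ _ (cf k)) => [y /VU[]//|j].
have [_ _ cU] := UP j.
by apply: Ck_sub (cU _) => y /VU[].
Qed.

Lemma ler_dist_half (R : realFieldType) (a b p q e : R) :
  p = q -> `|a - p| < e / 2 -> `|b - q| < e / 2 -> `|a - b| <= e.
Proof.
move=> -> /ltW ap /ltW bq; rewrite (splitr e) -(subrKA q).
by rewrite (le_trans (ler_normD _ _))// lerD// distrC.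
Qed.

(** * The mean value theorem and symmetry of second derivatives *)

Section MeanValue.
Context {R : realType} {V : normedModType R}.
Implicit Types (f : V -> R) (x y u v : V).

Lemma is_derive_line f y u (t : R) : differentiable f (y + t *: u) ->
  is_derive t 1 (fun s => f (y + s *: u)) ('D_u f (y + t *: u)).
Proof.
move=> df; pose h (s : R) := y + s *: u.
have dh : is_diff t h ( *:%R^~ u).
  have -> : h = cst y + ( *:%R^~ u) by [].
  by apply: is_diff_eq; rewrite add0r.
have dht : differentiable h t by exact: ex_diff.
have -> : (fun s => f (y + s *: u)) = f \o h by [].
have <- : 'D_1 (f \o h) t = 'D_u f (y + t *: u).
  by rewrite derive_comp// (deriveE _ dht) diff_val scale1r.
apply: derivableP; apply: diff_derivable; exact: differentiable_comp.
Qed.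

Lemma mean_value_line f y u (s : R) : 0 <= s ->
    (forall t, 0 <= t <= s -> differentiable f (y + t *: u)) ->
  exists2 t, 0 <= t <= s & f (y + s *: u) - f y = s * 'D_u f (y + t *: u).
Proof.
move=> s0 df.
have [||c] := @MVT_segment _ (fun t => f (y + t *: u))
    (fun t => 'D_u f (y + t *: u)) 0 s s0.
- move=> t; rewrite in_itv /= => /andP[/ltW t0 /ltW ts].
  by apply: is_derive_line; apply: df; rewrite t0.
- apply: continuous_in_subspaceT => t; rewrite inE /= in_itv /= => ts.
  have [dt _] := is_derive_line (df t ts).
  exact/differentiable_continuous/derivable1_diffP.
rewrite in_itv /= subr0 scale0r addr0 => cs ->.
by exists c => //; rewrite mulrC.
Qed.

Lemma near_line2 x u v (P : set V) : nbhs x P -> exists2 s : R, 0 < s &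
  forall a b, 0 <= a <= s -> 0 <= b <= s -> P (x + a *: u + b *: v).
Proof.
(* The summand 1 keeps [d] positive when [u] and [v] vanish; halving [r] makes the final estimate
   strict. *)
move=> /nbhs_ballP[r /= r0 rP]; pose d := `|u| + `|v| + 1.
have d0 : 0 < d by rewrite ltr_pwDr// addr_ge0.
exists (r / 2 / d) => [|a b /andP[a0 ad] /andP[b0 bd]].
  by rewrite !divr_gt0.
apply: rP; rewrite -ball_normE /ball_ /= opprD addrA opprD addrA subrr add0r.
rewrite -opprD normrN (le_lt_trans (ler_normD _ _))// !normrZ !ger0_norm//.
apply: (@le_lt_trans _ _ (r / 2 / d * d)).
  apply: (@le_trans _ _ (r / 2 / d * `|u| + r / 2 / d * `|v|)).
    by apply: lerD; apply: ler_wpM2r.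
  by rewrite -mulrDr ler_wpM2l ?divr_ge0 ?(ltW d0) ?(ltW r0)// /d lerDl.
by rewrite divfK ?gt_eqF// ltr_pdivrMr// ltr_pMr// ltr1n.
Qed.

Lemma locally_constant f x :
  (\forall y \near x, differentiable f y /\ forall v, 'D_v f y = 0) ->
  \forall y \near x, f y = f x.
Proof.
move=> /nbhs_ballP[r /= r0 rP]; apply/nbhs_ballP; exists r => //= y xy.
have seg t : 0 <= t <= 1 -> ball x r (x + t *: (y - x)).
  move=> /andP[t0 t1]; move: xy; rewrite -ball_normE /ball_ /= => xy.
  rewrite opprD addrA subrr add0r normrN normrZ ger0_norm//.
  by rewrite distrC; apply: le_lt_trans xy; rewrite ler_piMl.
have [||t t1] := @mean_value_line f x (y - x) 1; first exact: ler01.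
  by move=> t /seg/rP[].
rewrite scale1r (addrC x) subrK => /eqP.
by have [_ ->] := rP _ (seg _ t1); rewrite mulr0 subr_eq0 => /eqP.
Qed.

Lemma second_difference f x u v (s : R) : 0 < s ->
    (forall a b, 0 <= a <= s -> 0 <= b <= s ->
       differentiable f (x + a *: u + b *: v) /\
       differentiable (fun y => 'D_u f y) (x + a *: u + b *: v)) ->
  exists a b, [/\ 0 <= a <= s, 0 <= b <= s &
    f (x + s *: u + s *: v) - f (x + s *: u) - (f (x + s *: v) - f x)
    = s * (s * 'D_v (fun y => 'D_u f y) (x + a *: u + b *: v))].
Proof.
move=> s0 df; have ss : 0 <= s <= s by rewrite ltW/=.
have s00 : 0 <= (0 : R) <= s by rewrite lexx ltW.
pose h y := f (y + s *: v) - f y.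
have dfs t : 0 <= t <= s -> differentiable (f \o +%R^~ (s *: v)) (x + t *: u).
  by move=> ts; apply: differentiable_comp => //; have [] := df _ _ ts ss.
have df0 t : 0 <= t <= s -> differentiable f (x + t *: u).
  by move=> ts; have [] := df _ _ ts s00; rewrite scale0r addr0.
have [|a as_ hE] := @mean_value_line h x u s (ltW s0).
  by move=> t ts; apply: differentiableB; auto.
have [|b bs gE] := @mean_value_line (fun y =>
  'D_u f y) (x + a *: u) v s (ltW s0).
  by move=> t ts; have [] := df _ _ as_ ts.
exists a, b; split => //; rewrite -gE.
have -> : x + s *: u + s *: v = x + s *: v + s *: u by rewrite addrAC.
move: hE; rewrite /h (addrAC x) => ->; congr (_ * _).
have -> : (fun y => f (y + s *: v) - f y) = (f \o +%R^~ (s *: v)) - f by [].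
rewrite deriveB; [|exact/diff_derivable/dfs|exact/diff_derivable/df0].
congr (_ - _); rewrite derive_comp//; last by have [] := df _ _ as_ ss.
by congr ('D_ _ f _); rewrite deriveD// derive_id derive_cst addr0.
Qed.

(** The second difference of [f] along [s *: u] and [s *: v] is symmetric in [u] and [v], and two
    mean value steps turn it into [s * s] times either mixed derivative at some point of a small
    parallelogram. Continuity at [x] then identifies the two values there. *)
Lemma derive_comm f x u v :
    (\forall y \near x, differentiable f y /\
       forall w, differentiable (fun z => 'D_w f z) y) ->
    {for x, continuous (fun y => 'D_v (fun z => 'D_u f z) y)} ->
    {for x, continuous (fun y => 'D_u (fun z => 'D_v f z) y)} ->
  'D_v (fun z => 'D_u f z) x = 'D_u (fun z => 'D_v f z) x.
Proof.
move=> df /cvgrPdist_lt cA /cvgrPdist_lt cB.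
set A := 'D_v ('D_u f) in cA *; set B := 'D_u ('D_v f) in cB *.
apply/eqP; rewrite -subr_eq0 -normr_le0; apply/ler_addgt0Pl => e e0.
have e2 : 0 < e / 2 by rewrite divr_gt0.
have [s s0 sP] := near_line2 u v
  (filterI df (filterI (cA _ e2) (cB _ e2))).
have [a [b [as_ bs E1]]] := second_difference (v := v) (u := u) s0
  (fun a b as_ bs => let: conj (conj h1 h2) _ := sP a b as_ bs in conj h1 (h2
    u)).
have sP' c d : 0 <= c <= s -> 0 <= d <= s ->
    differentiable f (x + c *: v + d *: u) /\
    differentiable (fun y => 'D_v f y) (x + c *: v + d *: u).
  by move=> cs ds; rewrite addrAC; have [[h1 h2] _] := sP _ _ ds cs.
have [c [d [cs ds E2]]] := second_difference s0 sP'.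
have AB : A (x + a *: u + b *: v) = B (x + d *: u + c *: v).
  rewrite (addrAC x (d *: u)); apply/(mulfI (lt0r_neq0 s0))/(mulfI (lt0r_neq0
    s0)).
  apply: (etrans (esym E1)); apply: (etrans _ E2).
  by rewrite (addrAC x (s *: v)); ring.
have [_ [Aab _]] := sP _ _ as_ bs; have [_ [_ Bdc]] := sP _ _ ds cs.
by rewrite addr0; exact: (ler_dist_half AB Aab Bdc).
Qed.

End MeanValue.

Lemma smooth_germ_derive_comm (R : realType) (m : nat) (f : 'rV[R]_m -> R) x u
  v :
  smooth_germ x f ->
  'D_v (fun z => 'D_u f z) x = 'D_u (fun z => 'D_v f z) x.
Proof.
move=> sf; apply: derive_comm.
- move: (smooth_germ_near sf); apply: filterS => y sy.
  split=> [|w]; first exact: smooth_germ_differentiable.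
  exact/smooth_germ_differentiable/smooth_germ_derive.
- apply/differentiable_continuous/smooth_germ_differentiable.
  exact/smooth_germ_derive/smooth_germ_derive.
- apply/differentiable_continuous/smooth_germ_differentiable.
  exact/smooth_germ_derive/smooth_germ_derive.
Qed.

(** * Vector fields on manifolds *)

Section Manifold.
Context {R : realType} {m : nat} {M : topologicalType}.
Variable A : set (chart R m M).
Hypothesis manA : is_manifold A.
Implicit Types (c d : chart R m M) (p q : M) (f h : M -> R) (v w : tvec R M).

Lemma near_cdom c p : A c -> cdom c p -> \forall q \near p, cdom c q.
Proof. by move=> Ac cp; apply: open_nbhs_nbhs; split=> //;
  exact: (man_open_dom manA). Qed.

Lemma cinv_cvg c p : A c -> cdom c p -> cinv c @ cmap c p --> p.
Proof.
move=> Ac cp; have := man_cinv_continuous manA Ac cp.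
by rewrite /prop_for /continuous_at (man_cmapK manA Ac cp).
Qed.

Lemma near_cinvK c p : A c -> cdom c p ->
  \forall y \near cmap c p, cdom c (cinv c y) /\ cmap c (cinv c y) = y.
Proof.
move=> Ac cp; apply: near_open (man_open_img manA Ac) _ _; first by exists p.
by move=> _ [q cq <-]; rewrite !(man_cmapK manA Ac cq).
Qed.

Lemma smooth_at_chart c p f : A c -> cdom c p ->
  smooth_germ (cmap c p) (f \o cinv c) -> smooth_at A p f.
Proof.
move=> Ac cp sf d Ad dp.
apply: (@smooth_germ_eq _ _ _ ((f \o cinv c) \o (cmap c \o cinv d))).
  have : \forall y \near cmap d p, cdom c (cinv d y).
    by apply: cinv_cvg => //; exact: near_cdom.
  by apply: filterS => y cy /=; rewrite (man_cmapK manA Ac cy).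
apply: smooth_germ_comp; last by rewrite /= (man_cmapK manA Ad dp).
by move=> j; exact: (man_transition manA).
Qed.

Lemma smooth_at_eq p f h : (\forall q \near p, f q = h q) ->
  smooth_at A p f -> smooth_at A p h.
Proof.
move=> fh sf c Ac cp; apply: smooth_germ_eq (sf c Ac cp).
exact: (cinv_cvg Ac cp fh).
Qed.

Lemma smooth_at_near p f :
  smooth_at A p f -> \forall q \near p, smooth_at A q f.
Proof.
move=> sf; have [c Ac cp] := man_cover manA p.
have := smooth_germ_near (sf c Ac cp).
move=> /(man_cmap_continuous manA Ac cp); rewrite nbhs_simpl /= => sq.
near=> q; apply: (smooth_at_chart Ac); first by near: q; exact: near_cdom.
by near: q.
Unshelve. all: by end_near. Qed.

Lemma smooth_atD p f h :
  smooth_at A p f -> smooth_at A p h -> smooth_at A p (f + h).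
Proof. by move=> sf sh c Ac cp; apply: smooth_germD; [exact: sf|exact: sh]. Qed.

Lemma smooth_atM p f h :
  smooth_at A p f -> smooth_at A p h -> smooth_at A p (f * h).
Proof. by move=> sf sh c Ac cp; apply: smooth_germM; [exact: sf|exact: sh]. Qed.

Lemma smooth_at_cst p (a : R) : smooth_at A p (cst a).
Proof. by move=> c Ac cp; exact: smooth_germ_cst. Qed.

Lemma smooth_at_sum p n (f : 'I_n -> M -> R) :
  (forall i, smooth_at A p (f i)) -> smooth_at A p (\sum_i f i).
Proof.
move=> sf; elim/big_ind: _ => // [|u v]; first exact: smooth_at_cst.
exact: smooth_atD.
Qed.

Lemma smooth_at_coord c p j : A c -> cdom c p ->
  smooth_at A p (fun q => cmap c q 0 j).
Proof. by move=> Ac cp d Ad dp; exact: (man_transition manA). Qed.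

Definition chart_vec c p (a : 'rV[R]_m) : tvec R M := fun f =>
  if `[< smooth_at A p f >] then 'D_a (f \o cinv c) (cmap c p) else 0.

Lemma chart_vec_tangent c p a : A c -> cdom c p -> tangent A p (chart_vec c p
  a).
Proof. by move=> Ac cp; exists c, a. Qed.

Lemma chart_vecE c p a f :
  smooth_at A p f -> chart_vec c p a f = 'D_a (f \o cinv c) (cmap c p).
Proof. by move=> sf; rewrite /chart_vec asboolT. Qed.

Lemma smooth_at_differentiable c p f : A c -> cdom c p -> smooth_at A p f ->
  differentiable (f \o cinv c) (cmap c p).
Proof. by move=> Ac cp sf; apply: smooth_germ_differentiable; exact: sf. Qed.

Lemma chart_vec_sum c p a f : A c -> cdom c p -> smooth_at A p f ->
  chart_vec c p a f = \sum_j a 0 j * 'D_(delta_mx 0 j) (f \o cinv c) (cmap c p).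
Proof.
move=> Ac cp sf; rewrite chart_vecE// derive_sum_delta//.
exact: smooth_at_differentiable.
Qed.

(** Chain rule through the transition map from the chart in which [v] is given. Every tangent vector
    thus has a canonical form in any chart, its components being its values on the coordinate
    functions. *)
Lemma tangent_chart c p v : A c -> cdom c p -> tangent A p v ->
  v = chart_vec c p (\row_j v (fun q => cmap c q 0 j)).
Proof.
move=> Ac cp [d [a [Ad dp vE]]]; apply/funext => f; rewrite vE.
have [sf|sf] := pselect (smooth_at A p f); last by rewrite /chart_vec !asboolF.
rewrite asboolT// chart_vecE//; pose h := cmap c \o cinv d.
have hp : h (cmap d p) = cmap c p by rewrite /h /= (man_cmapK manA Ad dp).
have dh : differentiable h (cmap d p).
  apply: differentiable_row => j; apply: smooth_germ_differentiable.
  exact: (man_transition manA).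
have dfc : differentiable (f \o cinv c) (h (cmap d p)).
  by rewrite hp; exact: smooth_at_differentiable.
transitivity ('D_a ((f \o cinv c) \o h) (cmap d p)).
  apply: near_eq_derive; have : \forall y \near cmap d p, cdom c (cinv d y).
    by apply: cinv_cvg => //; exact: near_cdom.
  by apply: filterS => y cy /=; rewrite (man_cmapK manA Ac cy).
rewrite (derive_comp _ dh dfc) hp; congr ('D_ _ _ _); apply/rowP => j.
by rewrite derive_row// mxE asboolT//; exact: smooth_at_coord.
Qed.

Lemma chart_vec_linear c p (s : R) a b : A c -> cdom c p ->
  chart_vec c p (s *: a + b) = s *: chart_vec c p a + chart_vec c p b.
Proof.
move=> Ac cp; apply/funext => f; rewrite !fctE.
have [sf|sf] := pselect (smooth_at A p f); last first.
  by rewrite /chart_vec !asboolF// scaler0 addr0.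
have df := smooth_at_differentiable Ac cp sf.
by rewrite !chart_vecE// !deriveE// linearP.
Qed.

Lemma chart_vec0 c p : A c -> cdom c p -> chart_vec c p 0 = 0.
Proof.
move=> Ac cp; have := chart_vec_linear (-1) 0 0 Ac cp.
by rewrite scaler0 addr0 scaleN1r addNr.
Qed.

Lemma chart_vec_coord c p a j : A c -> cdom c p ->
  chart_vec c p a (fun q => cmap c q 0 j) = a 0 j.
Proof.
move=> Ac cp; rewrite chart_vecE; last exact: smooth_at_coord.
transitivity ('D_a (fun y : 'rV[R]_m => y 0 j) (cmap c p)).
  apply: near_eq_derive; move: (near_cinvK Ac cp).
  by apply: filterS => y [_ /= ->].
by rewrite -(derive_row _ _ (f := id))// derive_id.
Qed.

Lemma tangent_linear p (s : R) v w :
  tangent A p v -> tangent A p w -> tangent A p (s *: v + w).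
Proof.
have [c Ac cp] := man_cover manA p => /(tangent_chart Ac cp) ->.
move=> /(tangent_chart Ac cp) ->; rewrite -chart_vec_linear//.
exact: chart_vec_tangent.
Qed.

Lemma tangent0 p : tangent A p 0.
Proof.
have [c Ac cp] := man_cover manA p.
rewrite -(chart_vec0 Ac cp); exact: chart_vec_tangent.
Qed.

Lemma tangentD p v w : tangent A p v -> tangent A p w -> tangent A p (v + w).
Proof. by move=> tv tw; rewrite -[v]scale1r; exact: tangent_linear. Qed.

Lemma tangentZ p (s : R) v : tangent A p v -> tangent A p (s *: v).
Proof.
by move=> tv; rewrite -[_ *: _]addr0; apply: tangent_linear => //;
  exact: tangent0.
Qed.

Lemma tangent_not_smooth p v f : tangent A p v -> ~ smooth_at A p f -> v f = 0.
Proof. by move=> [c [a [_ _ ->]]] sf; rewrite asboolF. Qed.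

Lemma tvecD p v f h : tangent A p v -> smooth_at A p f -> smooth_at A p h ->
  v (f + h) = v f + v h.
Proof.
move=> [c [a [Ac cp ->]]] sf sh; rewrite !asboolT//; last exact: smooth_atD.
have -> : (f + h) \o cinv c = (f \o cinv c) + (h \o cinv c) by [].
by rewrite deriveD//; apply: diff_derivable; exact: smooth_at_differentiable.
Qed.

Lemma tvecM p v f h : tangent A p v -> smooth_at A p f -> smooth_at A p h ->
  v (f * h) = v f * h p + f p * v h.
Proof.
move=> [c [a [Ac cp ->]]] sf sh; rewrite !asboolT//; last exact: smooth_atM.
have -> : (f * h) \o cinv c = (f \o cinv c) * (h \o cinv c) by [].
rewrite deriveM; try by apply: diff_derivable; exact: smooth_at_differentiable.
by rewrite /= (man_cmapK manA Ac cp) addrC mulrC; congr (_ + _); rewrite mulrC.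
Qed.

Lemma tvec_cst p v (s : R) : tangent A p v -> v (cst s) = 0.
Proof.
move=> [c [a [Ac cp ->]]]; rewrite asboolT; last exact: smooth_at_cst.
have -> : cst s \o cinv c = cst s by [].
exact: derive_cst.
Qed.

Lemma tvec_sum p v n (f : 'I_n -> M -> R) : tangent A p v ->
  (forall i, smooth_at A p (f i)) -> v (\sum_i f i) = \sum_i v (f i).
Proof.
move=> tv; elim: n f => [|n IH] f sf.
  by rewrite !big_ord0 -[0]/(cst 0) (tvec_cst _ tv).
rewrite !big_ord_recl (tvecD tv)//; last by apply: smooth_at_sum => i;
  exact: sf.
by rewrite IH// => i; exact: sf.
Qed.

Lemma tvec_eq p v f h : tangent A p v ->
  (\forall q \near p, f q = h q) -> v f = v h.
Proof.
move=> [c [a [Ac cp ->]]] fh.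
have smE : smooth_at A p f <-> smooth_at A p h.
  split; apply: smooth_at_eq => //.
  by move: fh; apply: filterS => q ->.
rewrite (asbool_equiv_eq smE); case: ifP => // _.
by apply: near_eq_derive; exact: (cinv_cvg Ac cp fh).
Qed.

(** Dimension count: read in a chart, [L] is an injective endomorphism of the coordinate space,
    hence onto. Coordinates are used because the tangent vectors at [p] form a predicate, not a
    vector space type. *)
Lemma tangent_frame p (L : 'rV[R]_m -> tvec R M) :
    (forall a (u v : 'rV[R]_m), L (a *: u + v) = a *: L u + L v) ->
    (forall u, tangent A p (L u)) -> (forall u, L u = 0 -> u = 0) ->
  forall v, tangent A p v -> exists u, v = L u.
Proof.
move=> Ll Lt Li v tv; have [c Ac cp] := man_cover manA p.
pose co w : 'rV[R]_m := \row_j w (fun q : M => cmap c q 0 j).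
have coE w : tangent A p w -> w = chart_vec c p (co w) by exact: tangent_chart.
have coL : linear (co \o L).
  by move=> a u w; apply/rowP => j; rewrite !mxE Ll.
pose f : {linear 'rV[R]_m -> 'rV[R]_m} := HB.pack (co \o L)
  (GRing.isLinear.Build _ _ _ _ _ coL).
have fE u : co (L u) = u *m lin1_mx f by rewrite mul_rV_lin1.
have fi : row_full (lin1_mx f).
  rewrite row_full_unit -row_free_unit -kermx_eq0.
  apply/eqP/row_matrixP => i; rewrite row0; apply: Li.
  rewrite (coE (L _))// fE -row_mul mulmx_ker row0.
  exact: chart_vec0.
have /submxP[u uE] : (co v <= lin1_mx f)%MS by exact: submx_full.
by exists u; rewrite (coE v)// uE -fE -coE.
Qed.

Lemma smooth_locally_constant p f :
    (\forall q \near p, smooth_at A q f /\ forall v,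
      tangent A q v -> v f = 0) ->
  \forall q \near p, f q = f p.
Proof.
move=> f0; have [c Ac cp] := man_cover manA p.
have : \forall y \near cmap c p, (f \o cinv c) y = (f \o cinv c) (cmap c p).
  apply: locally_constant; near=> y.
  have [cy cyK] : cdom c (cinv c y) /\ cmap c (cinv c y) = y.
    by near: y; exact: near_cinvK.
  have [sy vy] : smooth_at A (cinv c y) f /\
      forall v, tangent A (cinv c y) v -> v f = 0.
    by near: y; exact: (cinv_cvg Ac cp f0).
  rewrite -cyK; split; first exact: smooth_at_differentiable.
  by move=> a; rewrite -chart_vecE// vy//; exact: chart_vec_tangent.
move=> /(man_cmap_continuous manA Ac cp); rewrite nbhs_simpl /= => fq.
near=> q; have cq : cdom c q by near: q; exact: near_cdom.
have : (f \o cinv c) (cmap c q) = (f \o cinv c) (cmap c p) by near: q.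
by rewrite /= !(man_cmapK manA Ac).
Unshelve. all: by end_near. Qed.

End Manifold.

Section Fields.
Context {R : realType} {m : nat} {M : topologicalType}.
Variable A : set (chart R m M).
Hypothesis manA : is_manifold A.
Implicit Types (c : chart R m M) (p q : M) (f h : M -> R) (X Y Z : vfield R M).

Lemma smooth_field_tangent p X : smooth_field_at A p X -> tangent A p (X p).
Proof. by move=> [tX _]; exact: nbhs_singleton tX. Qed.

Lemma smooth_field_eq p X Y : (\forall q \near p, X q = Y q) ->
  smooth_field_at A p X -> smooth_field_at A p Y.
Proof.
move=> XY [tX sX]; split; first by near=> q; rewrite -(near XY q)//; near: q.
move=> f sf; apply: smooth_at_eq (sX _ sf) => //.
by move: XY; apply: filterS => q ->.
Unshelve. all: by end_near. Qed.

Lemma smooth_fieldD p X Y : smooth_field_at A p X -> smooth_field_at A p Y ->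
  smooth_field_at A p (X + Y).
Proof.
move=> [tX sX] [tY sY]; split; last first.
  by move=> f sf; apply: smooth_atD; [exact: sX|exact: sY].
by near=> q; apply: tangentD => //; near: q.
Unshelve. all: by end_near. Qed.

Lemma smooth_fieldZ p h X : smooth_at A p h -> smooth_field_at A p X ->
  smooth_field_at A p (fun q => h q *: X q).
Proof.
move=> sh [tX sX]; split; last by move=> f sf; apply: smooth_atM; [|exact: sX].
by near=> q; apply: tangentZ => //; near: q.
Unshelve. all: by end_near. Qed.

Lemma smooth_field0 p : smooth_field_at A p 0.
Proof.
split; first by near=> q; exact: tangent0.
move=> f _; have -> : (fun q => (0 : vfield R M) q f) = cst 0 by [].
exact: smooth_at_cst.
Unshelve. all: by end_near. Qed.

Lemma smooth_field_sum p n (X : 'I_n -> vfield R M) :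
  (forall i, smooth_field_at A p (X i)) -> smooth_field_at A p (\sum_i X i).
Proof.
move=> sX; elim/big_ind: _ => // [|u w]; first exact: smooth_field0.
exact: smooth_fieldD.
Qed.

Lemma smooth_chart_field c p a : A c -> cdom c p ->
  smooth_field_at A p (fun q => chart_vec A c q a).
Proof.
move=> Ac cp; split.
  by near=> q; apply: chart_vec_tangent => //; near: q; exact: (near_cdom manA).
move=> f sf; apply: (smooth_at_chart manA Ac cp).
apply: (@smooth_germ_eq _ _ _ (fun y => 'D_a (f \o cinv c) y)); last first.
  exact/smooth_germ_derive/sf.
near=> y; have [cy cyK] : cdom c (cinv c y) /\ cmap c (cinv c y) = y.
  by near: y; exact: (near_cinvK manA).
rewrite /= chart_vecE ?cyK//; near: y.
exact: (cinv_cvg manA Ac cp (smooth_at_near manA sf)).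
Unshelve. all: by end_near. Qed.

Local Notation "'[ X , Y ]" := (bracket A X Y).

Lemma bracketE X Y p f : smooth_at A p f ->
  '[X, Y] p f = X p (fun q => Y q f) - Y p (fun q => X q f).
Proof. by move=> sf; rewrite /bracket asboolT. Qed.

Lemma bracket_not_smooth X Y p f : ~ smooth_at A p f -> '[X, Y] p f = 0.
Proof. by move=> sf; rewrite /bracket asboolF. Qed.

Lemma bracket_skew X Y p : '[X, Y] p = - '[Y, X] p.
Proof.
by apply/funext => f; rewrite !fctE /bracket; case: ifP => _;
  rewrite ?opprB ?oppr0.
Qed.

Lemma bracket_eqr p X Y Y' : tangent A p (X p) ->
  (\forall q \near p, Y q = Y' q) -> '[X, Y] p = '[X, Y'] p.
Proof.
move=> tX YY'; apply/funext => f; rewrite /bracket (nbhs_singleton YY').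
case: ifP => // _; congr (_ - _); apply: (tvec_eq manA tX).
by move: YY'; apply: filterS => q ->.
Qed.

Lemma bracketDr p X Y Z : smooth_field_at A p X -> smooth_field_at A p Y ->
  smooth_field_at A p Z -> '[X, Y + Z] p = '[X, Y] p + '[X, Z] p.
Proof.
move=> sX [_ sY] [_ sZ]; apply/funext => f; rewrite !fctE.
have [sf|sf] := pselect (smooth_at A p f); last first.
  by rewrite !bracket_not_smooth// addr0.
rewrite !bracketE// !fctE opprD addrACA.
by rewrite -(tvecD (smooth_field_tangent sX) (sY _ sf) (sZ _ sf)).
Qed.

Lemma bracketZr p X h Y : smooth_field_at A p X -> smooth_field_at A p Y ->
  smooth_at A p h ->
  '[X, fun q => h q *: Y q] p = X p h *: Y p + h p *: '[X, Y] p.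
Proof.
move=> sX [tY sY] sh; apply/funext => f; rewrite !fctE.
have tYp := nbhs_singleton tY.
have [sf|sf] := pselect (smooth_at A p f); last first.
  rewrite !bracket_not_smooth// (tangent_not_smooth tYp sf).
  by rewrite !scaler0 addr0.
rewrite !bracketE//.
have := tvecM manA (smooth_field_tangent sX) sh (sY _ sf).
have -> : (h * (fun q => Y q f))%R = (fun q => (h q *: Y q) f) by [].
by move=> ->; rewrite scalerBr addrA.
Qed.

Lemma bracket0r p X : tangent A p (X p) -> '[X, 0] p = 0.
Proof.
move=> tX; apply/funext => f; rewrite /bracket; case: ifP => // _.
by rewrite subr0 -[X in _ p X]/(cst 0) (tvec_cst _ tX).
Qed.

Lemma bracket_sumr p X n (Y : 'I_n -> vfield R M) : smooth_field_at A p X ->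
  (forall i, smooth_field_at A p (Y i)) ->
  '[X, \sum_i Y i] p = \sum_i '[X, Y i] p.
Proof.
move=> sX; elim: n Y => [|n IH] Y sY.
  by rewrite !big_ord0 bracket0r//; exact: smooth_field_tangent.
rewrite !big_ord_recl bracketDr//; last by apply: smooth_field_sum => i;
  exact: sY.
by rewrite IH// => i; exact: sY.
Qed.

(** In a chart the second-order terms cancel by the symmetry of mixed derivatives ([ddC]); what
    remains is the chart vector with components [X (Y^j) - Y (X^j)]. *)
Lemma tangent_bracket p X Y : smooth_field_at A p X -> smooth_field_at A p Y ->
  tangent A p ('[X, Y] p).
Proof.
move=> sX sY; have [c Ac cp] := man_cover manA p.
pose co Z q : 'rV[R]_m := \row_j Z q (fun q : M => cmap c q 0 j).
have [tX tY] := (smooth_field_tangent sX, smooth_field_tangent sY).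
pose d j f : M -> R := fun q => chart_vec A c q (delta_mx 0 j) f.
have sd j f : smooth_at A p f -> smooth_at A p (d j f).
  by move=> sf; have [_] := smooth_chart_field (delta_mx 0 j) Ac cp; exact.
have sco Z j : smooth_field_at A p Z -> smooth_at A p (fun q => co Z q 0 j).
  move=> [_ sZ]; have -> : (fun q => co Z q 0 j) = fun q => Z q (fun q =>
    cmap c q 0 j).
    by apply/funext => q; rewrite mxE.
  exact/sZ/smooth_at_coord.
have ZE Z f : smooth_field_at A p Z -> smooth_at A p f ->
    \forall q \near p, Z q f = (\sum_j ((fun q => co Z q 0 j) * d j f)%R) q.
  move=> [tZ _] sf; near=> q.
  have cq : cdom c q by near: q; exact: (near_cdom manA).
  have sq : smooth_at A q f by near: q; exact: (smooth_at_near manA).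
  have tq : tangent A q (Z q) by near: q.
  rewrite {1}(tangent_chart manA Ac cq tq) (chart_vec_sum _ Ac cq sq) fct_sumE.
  by apply: eq_bigr => j _; rewrite /d !fctE chart_vecE// !mxE.
have ZW Z W f : smooth_field_at A p Z -> smooth_field_at A p W ->
    smooth_at A p f -> Z p (fun q => W q f) =
    \sum_j (Z p (fun q => co W q 0 j) * d j f p + co W p 0 j * Z p (d j f)).
  move=> sZ sW sf; have tZ := smooth_field_tangent sZ.
  rewrite (tvec_eq manA tZ (ZE W f sW sf)) (tvec_sum tZ); last first.
    by move=> j; apply: smooth_atM; [exact: sco|exact: sd].
  by apply: eq_bigr => j _; rewrite (tvecM manA tZ)//; [exact: sco|exact: sd].
have -> : '[X, Y] p = chart_vec A c p
    (\row_j (X p (fun q => co Y q 0 j) - Y p (fun q => co X q 0 j))).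
  apply/funext => f.
  have [sf|sf] := pselect (smooth_at A p f); last first.
    by rewrite bracket_not_smooth// /chart_vec asboolF.
  rewrite bracketE// !ZW// !big_split /= opprD addrACA.
  have -> : \sum_i co Y p 0 i * X p (d i f) - \sum_i co X p 0 i * Y p (d i f)
    = 0.
    have dE Z j : smooth_field_at A p Z ->
        Z p (d j f) = \sum_i co Z p 0 i * d i (d j f) p.
      move=> sZ; rewrite (nbhs_singleton (ZE Z (d j f) sZ (sd _ _ sf)))
        fct_sumE.
      by [].
    have ddC k l : d k (d l f) p = d l (d k f) p.
      have ddE k' l' : d k' (d l' f) p =
          'D_(delta_mx 0 k') ('D_(delta_mx 0 l') (f \o cinv c)) (cmap c p).
        rewrite {1}/d chart_vecE; last exact: sd.
        apply: near_eq_derive; near=> y.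
        have [cy cyK] : cdom c (cinv c y) /\ cmap c (cinv c y) = y.
          by near: y; exact: (near_cinvK manA).
        rewrite /d /= chart_vecE ?cyK//; near: y.
        exact: (cinv_cvg manA Ac cp (smooth_at_near manA sf)).
      by rewrite !ddE; apply: smooth_germ_derive_comm; exact: sf.
    apply/eqP; rewrite subr_eq0; apply/eqP.
    transitivity (\sum_j \sum_i co Y p 0 j * (co X p 0 i * d i (d j f) p)).
      by apply: eq_bigr => j _; rewrite dE// mulr_sumr.
    rewrite exchange_big /=; apply: eq_bigr => i _; rewrite dE// mulr_sumr.
    by apply: eq_bigr => j _; rewrite mulrCA ddC.
  rewrite addr0 (chart_vec_sum _ Ac cp sf) -sumrB; apply: eq_bigr => j _.
  by rewrite mxE -mulrBl /d chart_vecE.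
exact: chart_vec_tangent.
Unshelve. all: by end_near. Qed.

End Fields.

Lemma near_cinv (R : realType) (m : nat) (M : topologicalType)
    (A : set (chart R m M)) c p (P : set M) : is_manifold A -> A c -> cdom c p
      ->
  nbhs p P -> \forall y \near cmap c p, P (cinv c y).
Proof. by move=> manA Ac cp Pp; exact: (cinv_cvg manA Ac cp Pp). Qed.

(** * Smooth maps, products and mixed derivatives *)

Section SmoothMaps.
Context {R : realType} {m n : nat} {M N : topologicalType}.
Variables (A : set (chart R m M)) (B : set (chart R n N)).
Hypotheses (manA : is_manifold A) (manB : is_manifold B).
Implicit Types (p : M) (v : tvec R M).

Lemma smooth_map_coord (F : M -> N) p c d (j : 'I_n) :
  smooth_map_at A B F p -> A c -> cdom c p -> B d -> cdom d (F p) ->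
  smooth_germ (cmap c p) (fun y => (cmap d (F (cinv c y))) 0 j).
Proof.
move=> [_ sF] Ac cp Bd dFp.
by have := sF _ (smooth_at_coord manB j Bd dFp); exact.
Qed.

Lemma near_map_cinv (F : M -> N) p c d : smooth_map_at A B F p ->
    A c -> cdom c p -> B d -> cdom d (F p) ->
  \forall y \near cmap c p, cdom d (F (cinv c y)).
Proof.
move=> [cF _] Ac cp Bd dFp.
apply: (near_cinv (P := fun q => cdom d (F q)) manA Ac cp).
exact: (cF _ (near_cdom manB Bd dFp)).
Qed.

Lemma smooth_map_const (q : N) p : smooth_map_at A B (fun=> q) p.
Proof.
split; first exact: cst_continuous.
by move=> f _; exact: smooth_at_cst.
Qed.

Lemma pushforwardE (F : M -> N) p v f : smooth_at B (F p) f ->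
  Defs.pushforward B F p v f = v (f \o F).
Proof. by move=> sf; rewrite /Defs.pushforward asboolT. Qed.

Lemma pushforward_linear (F : M -> N) p (a : R) v w :
  Defs.pushforward B F p (a *: v + w) = a *: Defs.pushforward B F p v +
    Defs.pushforward B F p w.
Proof.
apply/funext => f; rewrite !fctE /Defs.pushforward; case: ifP => // _.
by rewrite scaler0 addr0.
Qed.

Lemma pushforward_tangent (F : M -> N) p v : smooth_map_at A B F p ->
  tangent A p v -> tangent B (F p) (Defs.pushforward B F p v).
Proof.
move=> sF tv; have [c Ac cp] := man_cover manA p.
have [d Bd dFp] := man_cover manB (F p).
pose h := cmap d \o F \o cinv c.
have hp : h (cmap c p) = cmap d (F p) by rewrite /h /= (man_cmapK manA Ac cp).
have dh : differentiable h (cmap c p).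
  apply: differentiable_row => j; apply: smooth_germ_differentiable.
  exact: smooth_map_coord.
set a := \row_j v (fun q => cmap c q 0 j).
have -> : Defs.pushforward B F p v = chart_vec B d (F p) ('D_a h (cmap c p)).
  apply/funext => f; rewrite /Defs.pushforward /chart_vec;
    case: asboolP => // sf.
  have sfF := sF.2 _ sf.
  rewrite {1}(tangent_chart manA Ac cp tv) (chart_vecE _ _ sfF) -/a -hp.
  rewrite -derive_comp//; last by rewrite hp;
    exact: (smooth_at_differentiable Bd).
  apply: near_eq_derive; near=> y; rewrite /= (man_cmapK manB Bd)//.
  by near: y; exact: near_map_cinv.
exact: chart_vec_tangent.
Unshelve. all: by end_near. Qed.

End SmoothMaps.

Lemma smooth_map_id (R : realType) (m : nat) (M : topologicalType)
    (A : set (chart R m M)) p : smooth_map_at A A idfun p.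
Proof. by split=> // f; exact: cvg_id. Qed.

Lemma derive_row_mx (R : realType) (V : normedModType R) (n1 n2 : nat)
    (f1 : V -> 'rV[R]_n1) (f2 : V -> 'rV[R]_n2) x a :
  differentiable f1 x -> differentiable f2 x ->
  'D_a (fun y => row_mx (f1 y) (f2 y)) x = row_mx ('D_a f1 x) ('D_a f2 x).
Proof.
move=> d1 d2; have d12 : differentiable (fun y => row_mx (f1 y) (f2 y)) x.
  apply: differentiable_row => j; have [k ->|k ->] := split_ordP j.
    under eq_fun do rewrite row_mxEl.
    exact: (differentiable_comp d1 (differentiable_coord _ 0 k)).
  under eq_fun do rewrite row_mxEr.
  exact: (differentiable_comp d2 (differentiable_coord _ 0 k)).
apply/rowP => j; rewrite derive_row//; have [k ->|k ->] := split_ordP j.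
  by rewrite row_mxEl derive_row//; under eq_fun do rewrite row_mxEl.
by rewrite row_mxEr derive_row//; under eq_fun do rewrite row_mxEr.
Qed.

Section ProductMaps.
Context {R : realType} {m n1 n2 : nat} {M N1 N2 : topologicalType}.
Variables (A : set (chart R m M)) (B1 : set (chart R n1 N1)) (B2 : set (chart
  R n2 N2)).
Hypotheses (manA : is_manifold A) (manB1 : is_manifold B1) (manB2 :
  is_manifold B2).

Lemma smooth_at_prod c1 c2 (h : N1 * N2 -> R) p1 p2 :
    B1 c1 -> cdom c1 p1 -> B2 c2 -> cdom c2 p2 ->
    smooth_at (prod_atlas B1 B2) (p1, p2) h ->
  smooth_germ (row_mx (cmap c1 p1) (cmap c2 p2))
    (fun z => h (cinv c1 (lsubmx z), cinv c2 (rsubmx z))).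
Proof.
move=> Bc1 cp1 Bc2 cp2 sh.
by apply: (sh (prod_chart c1 c2)); [exists c1, c2|split].
Qed.

Lemma smooth_germ_row_mx (f1 : 'rV[R]_m -> 'rV[R]_n1) (f2 : 'rV[R]_m ->
  'rV[R]_n2) x :
  (forall j, smooth_germ x (fun y => f1 y 0 j)) ->
  (forall j, smooth_germ x (fun y => f2 y 0 j)) ->
  forall j, smooth_germ x (fun y => row_mx (f1 y) (f2 y) 0 j).
Proof.
move=> s1 s2 j; have [k kE|k kE] := split_ordP j.
  by have -> : (fun y => row_mx (f1 y) (f2 y) 0 j) = (fun y => f1 y 0 k)
    by apply/funext => y; rewrite kE row_mxEl.
by have -> : (fun y => row_mx (f1 y) (f2 y) 0 j) = (fun y => f2 y 0 k)
  by apply/funext => y; rewrite kE row_mxEr.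
Qed.

Lemma smooth_at_pair (h : N1 * N2 -> R) (al : M -> N1) (be : M -> N2) q :
    smooth_map_at A B1 al q -> smooth_map_at A B2 be q ->
    smooth_at (prod_atlas B1 B2) (al q, be q) h ->
  smooth_at A q (fun x => h (al x, be x)).
Proof.
move=> sal sbe sh; have [c Ac cq] := man_cover manA q.
have [c1 Bc1 cq1] := man_cover manB1 (al q).
have [c2 Bc2 cq2] := man_cover manB2 (be q).
apply: (smooth_at_chart manA Ac cq).
pose F (y : 'rV[R]_m) := row_mx (cmap c1 (al (cinv c y))) (cmap c2 (be (cinv c
  y))).
apply: (@smooth_germ_eq _ _ _
  ((fun z => h (cinv c1 (lsubmx z), cinv c2 (rsubmx z))) \o F)).
  near=> y; rewrite /F /= row_mxKl row_mxKr (man_cmapK manB1 Bc1); last first.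
    by near: y; exact: (near_map_cinv manA manB1).
  rewrite (man_cmapK manB2 Bc2)//.
  by near: y; exact: (near_map_cinv manA manB2).
apply: smooth_germ_comp.
  by apply: smooth_germ_row_mx => j; apply: smooth_map_coord; eauto.
by rewrite /F (man_cmapK manA Ac cq); exact: smooth_at_prod.
Unshelve. all: by end_near. Qed.

(** The differential of [h] is linear and [row_mx d1 d2 = row_mx d1 0 + row_mx 0 d2]. In a Lie group
    this is the product rule for [al x * be x]. *)
Lemma tvec_pair (h : N1 * N2 -> R) (al : M -> N1) (be : M -> N2) q v :
    smooth_map_at A B1 al q -> smooth_map_at A B2 be q ->
    smooth_at (prod_atlas B1 B2) (al q, be q) h -> tangent A q v ->
  v (fun x => h (al x, be x)) =
  v (fun x => h (al x, be q)) + v (fun x => h (al q, be x)).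
Proof.
move=> sal sbe sh tv; have [c Ac cq] := man_cover manA q.
have [c1 Bc1 cq1] := man_cover manB1 (al q).
have [c2 Bc2 cq2] := man_cover manB2 (be q).
set a := \row_j v (fun q => cmap c q 0 j).
pose H z := h (cinv c1 (lsubmx z), cinv c2 (rsubmx z)).
have dH : differentiable H (row_mx (cmap c1 (al q)) (cmap c2 (be q))).
  exact/smooth_germ_differentiable/smooth_at_prod.
pose d1 := 'D_a (fun y => cmap c1 (al (cinv c y))) (cmap c q).
pose d2 := 'D_a (fun y => cmap c2 (be (cinv c y))) (cmap c q).
(* One formula serves all three terms: in two of them [al] or [be] is replaced by a constant map,
   whose differential is 0. *)
have key (al' : M -> N1) (be' : M -> N2) : al' q = al q -> be' q = be q ->
    smooth_map_at A B1 al' q -> smooth_map_at A B2 be' q ->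
    v (fun x => h (al' x, be' x)) =
    'D_(row_mx ('D_a (fun y => cmap c1 (al' (cinv c y))) (cmap c q))
               ('D_a (fun y => cmap c2 (be' (cinv c y))) (cmap c q)))
      H (row_mx (cmap c1 (al q)) (cmap c2 (be q))).
  move=> alq beq sal' sbe'.
  have shq : smooth_at A q (fun x => h (al' x, be' x)).
    by apply: smooth_at_pair => //; rewrite alq beq.
  rewrite {1}(tangent_chart manA Ac cq tv) chart_vecE// -/a.
  pose F (y : 'rV[R]_m) :=
    row_mx (cmap c1 (al' (cinv c y))) (cmap c2 (be' (cinv c y))).
  have Fq : F (cmap c q) = row_mx (cmap c1 (al q)) (cmap c2 (be q)).
    by rewrite /F (man_cmapK manA Ac cq) alq beq.
  have s1 j : smooth_germ (cmap c q) (fun y => cmap c1 (al' (cinv c y)) 0 j).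
    by apply: (smooth_map_coord manB1 j sal') => //; rewrite alq.
  have s2 j : smooth_germ (cmap c q) (fun y => cmap c2 (be' (cinv c y)) 0 j).
    by apply: (smooth_map_coord manB2 j sbe') => //; rewrite beq.
  have dF : differentiable F (cmap c q).
    apply: differentiable_row => j; apply: smooth_germ_differentiable.
    exact: smooth_germ_row_mx.
  transitivity ('D_a (H \o F) (cmap c q)).
    apply: near_eq_derive; near=> y; rewrite /H /F /= row_mxKl row_mxKr.
    rewrite (man_cmapK manB1 Bc1); last first.
      by near: y; apply: (near_map_cinv manA manB1) => //; rewrite alq.
    rewrite (man_cmapK manB2 Bc2)//.
    by near: y; apply: (near_map_cinv manA manB2) => //; rewrite beq.
  rewrite derive_comp// ?Fq//; congr ('D_ _ H _); apply: derive_row_mx.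
    by apply: differentiable_row => i; exact: smooth_germ_differentiable.
  by apply: differentiable_row => i; exact: smooth_germ_differentiable.
have c0 k (y : 'rV[R]_k) : 'D_a (fun=> y) (cmap c q) = 0 by exact: derive_cst.
have sc1 : smooth_map_at A B1 (fun=> al q) q by exact: smooth_map_const.
have sc2 : smooth_map_at A B2 (fun=> be q) q by exact: smooth_map_const.
rewrite (key al be)// (key al (fun=> be q))// (key (fun=> al q) be)// !c0.
rewrite !(deriveE _ dH) -/d1 -/d2.
have -> : row_mx d1 d2 = row_mx d1 0 + row_mx 0 d2.
  by rewrite add_row_mx addr0 add0r.
by rewrite linearD.
Unshelve. all: by end_near. Qed.

End ProductMaps.

Section RowSlices.
Context {R : realType} {n1 n2 : nat}.
Implicit Types (x : 'rV[R]_n1) (y : 'rV[R]_n2) (H : 'rV[R]_(n1 + n2) -> R).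

Lemma smooth_row_mxl x y j : smooth_germ x (fun x => row_mx x y 0 j).
Proof.
move: j; apply: smooth_germ_row_mx => j; first exact: smooth_germ_coord.
exact: smooth_germ_cst.
Qed.

Lemma smooth_row_mxr x y j : smooth_germ y (fun y => row_mx x y 0 j).
Proof.
move: j; apply: smooth_germ_row_mx => j; first exact: smooth_germ_cst.
exact: smooth_germ_coord.
Qed.

Lemma differentiable_row_mxl x y : differentiable (fun x => row_mx x y) x.
Proof.
apply: differentiable_row => j.
exact/smooth_germ_differentiable/smooth_row_mxl.
Qed.

Lemma differentiable_row_mxr x y : differentiable (row_mx x) y.
Proof.
apply: differentiable_row => j.
exact/smooth_germ_differentiable/smooth_row_mxr.
Qed.

Lemma derive_row_mxl x y a H : differentiable H (row_mx x y) ->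
  'D_a (fun x => H (row_mx x y)) x = 'D_(row_mx a 0) H (row_mx x y).
Proof.
move=> dH; have dr := differentiable_row_mxl x y.
rewrite (derive_comp a dr dH); congr ('D_ _ H _).
by rewrite derive_row_mx ?derive_id ?derive_cst//; exact: differentiable_cst.
Qed.

Lemma derive_row_mxr x y b H : differentiable H (row_mx x y) ->
  'D_b (fun y => H (row_mx x y)) y = 'D_(row_mx 0 b) H (row_mx x y).
Proof.
move=> dH; have dr := differentiable_row_mxr x y.
rewrite (derive_comp b dr dH); congr ('D_ _ H _).
by rewrite derive_row_mx ?derive_id ?derive_cst//; exact: differentiable_cst.
Qed.

End RowSlices.

Section MixedDerivatives.
Context {R : realType} {n1 n2 : nat} {N1 N2 : topologicalType}.
Variables (B1 : set (chart R n1 N1)) (B2 : set (chart R n2 N2)).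
Hypotheses (manB1 : is_manifold B1) (manB2 : is_manifold B2).
Variables (h : N1 * N2 -> R) (p1 : N1) (p2 : N2).
Hypothesis sh : smooth_at (prod_atlas B1 B2) (p1, p2) h.
Variables (v : tvec R N1) (w : tvec R N2).
Hypotheses (tv : tangent B1 p1 v) (tw : tangent B2 p2 w).

Section Charts.
Variables (c1 : chart R n1 N1) (c2 : chart R n2 N2).
Hypotheses (Bc1 : B1 c1) (cp1 : cdom c1 p1) (Bc2 : B2 c2) (cp2 : cdom c2 p2).

Let H z := h (cinv c1 (lsubmx z), cinv c2 (rsubmx z)).
Let x1 := cmap c1 p1.
Let x2 := cmap c2 p2.
Let a := \row_j v (fun q => cmap c1 q 0 j).
Let b := \row_j w (fun q => cmap c2 q 0 j).

Let HE x y : H (row_mx x y) = h (cinv c1 x, cinv c2 y).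
Proof. by rewrite /H row_mxKl row_mxKr. Qed.

Let sH : smooth_germ (row_mx x1 x2) H.
Proof. exact: (smooth_at_prod Bc1 cp1 Bc2 cp2 sh). Qed.

Let near_left : \forall x \near x1, smooth_germ (row_mx x x2) H.
Proof.
exact: (differentiable_continuous (differentiable_row_mxl x1 x2)
  (smooth_germ_near sH)).
Qed.

Let near_right : \forall y \near x2, smooth_germ (row_mx x1 y) H.
Proof.
exact: (differentiable_continuous (differentiable_row_mxr x1 x2)
  (smooth_germ_near sH)).
Qed.

Let left_slice : \forall x \near x1,
  w (fun t => h (cinv c1 x, t)) = 'D_(row_mx 0 b) H (row_mx x x2).
Proof.
move: near_left; apply: filterS => x sHx.
have HF : (fun t => h (cinv c1 x, t)) \o cinv c2 = H \o row_mx x.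
  by apply/funext => y /=; rewrite HE.
have shx : smooth_at B2 p2 (fun t => h (cinv c1 x, t)).
  apply: (smooth_at_chart manB2 Bc2 cp2); rewrite HF.
  by apply: smooth_germ_comp => // j; exact: smooth_row_mxr.
rewrite {1}(tangent_chart manB2 Bc2 cp2 tw) chart_vecE// HF -/b.
exact/derive_row_mxr/smooth_germ_differentiable.
Qed.

Let right_slice : \forall y \near x2,
  v (fun s => h (s, cinv c2 y)) = 'D_(row_mx a 0) H (row_mx x1 y).
Proof.
move: near_right; apply: filterS => y sHy.
have HF : (fun s => h (s, cinv c2 y)) \o cinv c1 = H \o (fun x => row_mx x y).
  by apply/funext => x /=; rewrite HE.
have shy : smooth_at B1 p1 (fun s => h (s, cinv c2 y)).
  apply: (smooth_at_chart manB1 Bc1 cp1); rewrite HF.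
  by apply: smooth_germ_comp => // j; exact: smooth_row_mxl.
rewrite {1}(tangent_chart manB1 Bc1 cp1 tv) chart_vecE// HF -/a.
exact/derive_row_mxl/smooth_germ_differentiable.
Qed.

Lemma smooth_at_slice_derive_chart :
  smooth_at B1 p1 (fun s => w (fun t => h (s, t))).
Proof.
apply: (smooth_at_chart manB1 Bc1 cp1).
apply: (@smooth_germ_eq _ _ _ ('D_(row_mx 0 b) H \o (fun x => row_mx x x2))).
  by move: left_slice; apply: filterS => x /= ->.
apply: smooth_germ_comp; last exact: (smooth_germ_derive _ sH).
by move=> j; exact: smooth_row_mxl.
Qed.

Lemma smooth_at_slice_derive_chart' :
  smooth_at B2 p2 (fun t => v (fun s => h (s, t))).
Proof.
apply: (smooth_at_chart manB2 Bc2 cp2).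
apply: (@smooth_germ_eq _ _ _ ('D_(row_mx a 0) H \o row_mx x1)).
  by move: right_slice; apply: filterS => x /= ->.
apply: smooth_germ_comp; last exact: (smooth_germ_derive _ sH).
by move=> j; exact: smooth_row_mxr.
Qed.

(** In a product chart both sides are second derivatives of [H], in the directions [row_mx a 0] and
    [row_mx 0 b]. Its purpose is the commutation of left- and right-invariant fields. *)
Lemma mixed_derivative_chart :
  v (fun s => w (fun t => h (s, t))) = w (fun t => v (fun s => h (s, t))).
Proof.
rewrite {1}(tangent_chart manB1 Bc1 cp1 tv) chart_vecE; last first.
  exact: smooth_at_slice_derive_chart.
rewrite {2}(tangent_chart manB2 Bc2 cp2 tw) chart_vecE; last first.
  exact: smooth_at_slice_derive_chart'.
rewrite -/a -/b.
transitivity ('D_(row_mx a 0) ('D_(row_mx 0 b) H) (row_mx x1 x2)).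
  rewrite -derive_row_mxl; last exact: (smooth_germ_differentiable
    (smooth_germ_derive _ sH)).
  by apply: near_eq_derive; move: left_slice; apply: filterS => x /= ->.
transitivity ('D_(row_mx 0 b) ('D_(row_mx a 0) H) (row_mx x1 x2)).
  exact: (smooth_germ_derive_comm _ _ sH).
rewrite -derive_row_mxr; last exact: (smooth_germ_differentiable
  (smooth_germ_derive _ sH)).
by apply: near_eq_derive; move: right_slice; apply: filterS => x /= ->.
Qed.

End Charts.

Lemma smooth_at_slice_derive : smooth_at B1 p1 (fun s => w (fun t => h (s, t))).
Proof.
have [c1 Bc1 cp1] := man_cover manB1 p1;
  have [c2 Bc2 cp2] := man_cover manB2 p2.
exact: (smooth_at_slice_derive_chart Bc1 cp1 Bc2 cp2).
Qed.

Lemma mixed_derivative :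
  v (fun s => w (fun t => h (s, t))) = w (fun t => v (fun s => h (s, t))).
Proof.
have [c1 Bc1 cp1] := man_cover manB1 p1;
  have [c2 Bc2 cp2] := man_cover manB2 p2.
exact: (mixed_derivative_chart Bc1 cp1 Bc2 cp2).
Qed.

End MixedDerivatives.

(** * Lie groups *)

(** The fibres of [F] are open and closed, and the image of a path is connected. The target is an
    arbitrary type so that the lemma serves real functions as well as maps into the group. *)
Lemma locally_constant_path_connected (R : realType) (T : topologicalType)
    (Y : Type) (F : T -> Y) : simply_connected (R := R) T ->
  (forall x, \forall y \near x, F y = F x) -> forall x y, F x = F y.
Proof.
move=> [pathT _] locF x y; have [gam [cgam <- <-]] := pathT x y.
pose I := gam @` `[0, 1]; pose C : set T := [set z | F z = F (gam 0)].
have oF (D : set Y) : open (F @^-1` D).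
  rewrite openE => z Dz; rewrite /interior; move: (locF z).
  by apply: filterS => z' /= ->.
have oC : open C by apply: (oF [set F (gam 0)]).
have cC : closed C.
  have -> : C = ~` (F @^-1` (~` [set F (gam 0)])).
    by rewrite preimage_setC setCK.
  exact/open_closedC/oF.
have cI : connected I.
  by apply: connected_continuous_connected => //; exact: segment_connected.
have g0 : I (gam 0) by exists 0 => //=; rewrite in_itv /= lexx ler01.
have g1 : I (gam 1) by exists 1 => //=; rewrite in_itv /= lexx ler01.
have : I `&` C = I.
  apply: cI; first by exists (gam 0).
    by exists C.
  by exists C.
by move=> /seteqP[_ /(_ _ g1)] [_ /esym].
Qed.

Lemma near_map (R : realType) (m n : nat) (M N : topologicalType)
    (A : set (chart R m M)) (B : set (chart R n N)) (F : M -> N) p (P : set N) :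
  smooth_map_at A B F p -> nbhs (F p) P -> \forall q \near p, P (F q).
Proof. by move=> [cF _]; exact: cF. Qed.

Section LieGroupFields.
Context {R : realType} {m : nat} {G : groupSpaceType}.
Variable A : set (chart R m G).
Hypothesis lieG : is_lie_group A.
Let manA : is_manifold A := lie_manifold lieG.
Implicit Types (x y a : G) (u v w : tvec R G) (f : G -> R).
Local Notation one := (1%g : G).

Lemma smooth_at_mul x y f : smooth_at A (x * y)%g f ->
  smooth_at (prod_atlas A A) (x, y) (fun z => f (z.1 * z.2)%g).
Proof. by move=> sf; have [_] := lie_mul lieG (x, y); exact. Qed.

Lemma smooth_mapM (l : nat) (N : topologicalType) (B : set (chart R l N))
    (al be : N -> G) q : is_manifold B ->
    smooth_map_at B A al q -> smooth_map_at B A be q ->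
  smooth_map_at B A (fun t => al t * be t)%g q.
Proof.
move=> manB sal sbe; split; last first.
  move=> f /smooth_at_mul sf.
  exact: (smooth_at_pair manB manA manA sal sbe sf).
have [cm _] := lie_mul lieG (al q, be q).
apply: (@continuous_comp _ _ _ (fun t => (al t, be t)) (fun z =>
  z.1 * z.2)%g) => //.
by apply: cvg_pair; [exact: sal.1|exact: sbe.1].
Qed.

Definition rtrans (a b : G) : G := (b * a)%g.

Lemma smooth_ltrans a x : smooth_map_at A A (ltrans a) x.
Proof.
apply: smooth_mapM => //; last exact: smooth_map_id.
exact: smooth_map_const.
Qed.

Lemma smooth_rtrans a x : smooth_map_at A A (rtrans a) x.
Proof.
apply: smooth_mapM => //; first exact: smooth_map_id.
exact: smooth_map_const.
Qed.

Definition linv_field v : vfield R G := fun x =>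
  Defs.pushforward A (ltrans x) 1%g v.
Definition rinv_field v : vfield R G := fun x =>
  Defs.pushforward A (rtrans x) 1%g v.

Lemma linv_fieldE v x f : smooth_at A x f ->
  linv_field v x f = v (fun s => f (x * s)%g).
Proof.
by move=> sf; rewrite /linv_field /Defs.pushforward /ltrans mulg1 asboolT.
Qed.

Lemma rinv_fieldE v x f : smooth_at A x f ->
  rinv_field v x f = v (fun s => f (s * x)%g).
Proof.
by move=> sf; rewrite /rinv_field /Defs.pushforward /rtrans mul1g asboolT.
Qed.

Lemma linv_field_tangent v x : tangent A 1%g v -> tangent A x (linv_field v x).
Proof.
move=> tv; rewrite -[x in tangent A x _]mulg1.
exact: (pushforward_tangent manA manA (smooth_ltrans x 1%g) tv).
Qed.

Lemma rinv_field_tangent v x : tangent A 1%g v -> tangent A x (rinv_field v x).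
Proof.
move=> tv; rewrite -[x in tangent A x _]mul1g.
exact: (pushforward_tangent manA manA (smooth_rtrans x 1%g) tv).
Qed.

Lemma linv_field_smooth v x : tangent A 1%g v -> smooth_field_at A x
  (linv_field v).
Proof.
move=> tv; split; first by near=> y; exact: linv_field_tangent.
move=> f sf; apply: (@smooth_at_eq _ _ _ A manA _ (fun y => v (fun s =>
  f (y * s)%g))).
  by move: (smooth_at_near manA sf); apply: filterS => y /linv_fieldE ->.
have sf1 : smooth_at A (x * 1)%g f by rewrite mulg1.
exact: (smooth_at_slice_derive manA manA (smooth_at_mul sf1) tv).
Unshelve. all: by end_near. Qed.

Lemma smooth_at_slice_derive_swap h v x : tangent A 1%g v ->
  smooth_at (prod_atlas A A) (one, x) h ->
  smooth_at A x (fun y => v (fun s => h (s, y))).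
Proof.
move=> tv sh.
have [c1 Ac1 c11] := man_cover manA one; have [c2 Ac2 c2x] := man_cover manA x.
exact: (smooth_at_slice_derive_chart' manA manA sh tv Ac1 c11 Ac2 c2x).
Qed.

Lemma rinv_field_smooth v x : tangent A 1%g v -> smooth_field_at A x
  (rinv_field v).
Proof.
move=> tv; split; first by near=> y; exact: rinv_field_tangent.
move=> f sf; apply: (@smooth_at_eq _ _ _ A manA _ (fun y => v (fun s =>
  f (s * y)%g))).
  by move: (smooth_at_near manA sf); apply: filterS => y /rinv_fieldE ->.
have sf1 : smooth_at A (1 * x)%g f by rewrite mul1g.
exact: (smooth_at_slice_derive_swap tv (smooth_at_mul sf1)).
Unshelve. all: by end_near. Qed.

Lemma linv_field1 v : tangent A 1%g v -> linv_field v 1%g = v.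
Proof.
move=> tv; apply/funext => f.
have [sf|sf] := pselect (smooth_at A 1%g f); last first.
  by rewrite !(tangent_not_smooth _ sf)//; exact: linv_field_tangent.
by rewrite linv_fieldE//; congr v; apply/funext => s; rewrite mul1g.
Qed.

Lemma rinv_field1 v : tangent A 1%g v -> rinv_field v 1%g = v.
Proof.
move=> tv; apply/funext => f.
have [sf|sf] := pselect (smooth_at A 1%g f); last first.
  by rewrite !(tangent_not_smooth _ sf)//; exact: rinv_field_tangent.
by rewrite rinv_fieldE//; congr v; apply/funext => s; rewrite mulg1.
Qed.

Lemma linv_field_pushforward v a x : tangent A 1%g v ->
  linv_field v (a * x)%g = Defs.pushforward A (ltrans a) x (linv_field v x).
Proof.
move=> tv; apply/funext => f.
have [sf|sf] := pselect (smooth_at A (a * x)%g f); last first.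
  rewrite (tangent_not_smooth _ sf); last exact: linv_field_tangent.
  by rewrite /Defs.pushforward asboolF.
rewrite pushforwardE// !linv_fieldE//; last exact: (smooth_ltrans a x).2.
by congr v; apply/funext => s; rewrite /= /ltrans mulgA.
Qed.

Lemma linv_field_invariant v : tangent A 1%g v ->
  left_invariant_field A (linv_field v).
Proof.
move=> tv; split=> [b|a b]; first exact: linv_field_smooth.
exact: linv_field_pushforward.
Qed.

Lemma linv_field_linear (a : R) v w x :
  linv_field (a *: v + w) x = a *: linv_field v x + linv_field w x.
Proof. exact: pushforward_linear. Qed.

Lemma linv_field_inj v x : tangent A 1%g v -> linv_field v x = 0 -> v = 0.
Proof.
move=> tv v0; apply/funext => f.
have [sf|sf] := pselect (smooth_at A 1%g f); last first.
  by rewrite (tangent_not_smooth tv sf).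
have sfx : smooth_at A x (f \o ltrans x^-1%g).
  by apply: (smooth_ltrans _ x).2; rewrite /ltrans mulVg.
have := congr1 (fun v => v (f \o ltrans x^-1%g)) v0; rewrite linv_fieldE//.
by under eq_fun do rewrite /= /ltrans mulKg.
Qed.

Lemma linv_field_bracket v w a x : tangent A 1%g v -> tangent A 1%g w ->
  bracket A (linv_field v) (linv_field w) (a * x)%g =
  Defs.pushforward A (ltrans a) x (bracket A (linv_field v) (linv_field w) x).
Proof.
move=> tv tw; apply/funext => f.
have [sf|sf] := pselect (smooth_at A (a * x)%g f); last first.
  by rewrite bracket_not_smooth// /Defs.pushforward asboolF.
have sfa : smooth_at A x (f \o ltrans a) by exact: (smooth_ltrans a x).2.
have key v' w' : tangent A 1%g v' -> tangent A 1%g w' ->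
    linv_field v' (a * x)%g (fun q => linv_field w' q f) =
    linv_field v' x (fun q => linv_field w' q (f \o ltrans a)).
  move=> tv' tw'; rewrite linv_field_pushforward// pushforwardE; last first.
    by have [_] := linv_field_smooth (a * x)%g tw'; exact.
  apply: (tvec_eq manA (linv_field_tangent x tv')).
  have : \forall y \near x, smooth_at A (a * y)%g f.
    exact: (near_map (smooth_ltrans a x) (smooth_at_near manA sf)).
  apply: filterS => y sfy /=.
  by rewrite {1}/ltrans linv_field_pushforward// pushforwardE.
by rewrite bracketE// pushforwardE// bracketE// !key.
Qed.

(** Left and right translations commute: both iterated derivatives are mixed derivatives of
    [f (t * x * s)] in [t] and [s] at the identity. *)
Lemma linv_rinv_bracket v w x : tangent A 1%g v -> tangent A 1%g w ->
  bracket A (linv_field v) (rinv_field w) x = 0.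
Proof.
move=> tv tw; apply/funext => f.
have [sf|sf] := pselect (smooth_at A x f); last by rewrite bracket_not_smooth.
rewrite bracketE//; apply/eqP; rewrite subr_eq0; apply/eqP.
have tvx := linv_field_tangent x tv.
have sf1 : smooth_at A (1 * x)%g f by rewrite mul1g.
have nearf : \forall t \near one, smooth_at A (t * x)%g f.
  exact: (near_map (smooth_rtrans x 1%g) (smooth_at_near manA sf1)).
transitivity (linv_field v x (fun q => w (fun t => f (t * q)%g))).
  apply: (tvec_eq manA tvx); move: (smooth_at_near manA sf).
  by apply: filterS => y /rinv_fieldE ->.
rewrite -(mixed_derivative manA manA (smooth_at_mul sf1) tw tvx).
rewrite rinv_fieldE; last by have [_] := linv_field_smooth x tv; exact.
apply: (tvec_eq manA tw); move: nearf; apply: filterS => t sft.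
rewrite linv_fieldE; last first.
  exact: (smooth_ltrans t x).2.
by rewrite linv_fieldE//; under eq_fun do rewrite mulgA.
Qed.

(** Differentiate [s^-1 * s = 1] with the product rule [tvec_pair]. *)
Lemma tvec_inv v (k : G -> R) : tangent A 1%g v -> smooth_at A 1%g k ->
  v (fun s => k s^-1%g) = - v k.
Proof.
move=> tv sk; have sk1 : smooth_at A (1^-1 * 1)%g k by rewrite invg1 mulg1.
have := tvec_pair manA manA manA (lie_inv lieG 1%g) (smooth_map_id A 1%g)
  (smooth_at_mul sk1) tv.
under eq_fun do rewrite /= mulVg.
rewrite -[X in v X]/(cst (k 1%g)) (tvec_cst _ tv) => /esym/eqP.
rewrite addr_eq0 => /eqP; under eq_fun do rewrite /= mulg1.
by move=> ->; congr (- v _); apply/funext => s; rewrite /= invg1 mul1g.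
Qed.

Lemma rinv_linv_commutative : simply_connected (R := R) G ->
    (forall v x, tangent A x v -> exists2 u,
      tangent A 1%g u & v = linv_field u x) ->
    (forall v x, tangent A 1%g v -> rinv_field v x = linv_field v x) ->
  forall x y : G, (x * y)%g = (y * x)%g.
Proof.
move=> scG frame rl x a.
pose Phi y : G := (y^-1 * (a * y))%g.
suff : Phi x = Phi 1%g.
  rewrite /Phi invg1 mul1g mulg1 => h.
  by rewrite -{1}h mulgA mulgV mul1g.
apply: (locally_constant_path_connected (F := Phi) scG) => {}x.
have sPhi y : smooth_map_at A A Phi y.
  by apply: smooth_mapM => //; [exact: lie_inv|exact: smooth_ltrans].
have [d Ad dx] := man_cover manA (Phi x).
have coP (j : 'I_m) :
    \forall y \near x, cmap d (Phi y) 0 j = cmap d (Phi x) 0 j.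
  have sj := smooth_at_coord manA j Ad dx.
  apply: (smooth_locally_constant manA (f := fun y => cmap d (Phi y) 0 j)).
  have near_s : \forall y \near x, smooth_at A (Phi y) (fun q => cmap d q 0 j).
    exact: (near_map (sPhi x) (smooth_at_near manA sj)).
  apply: filterS near_s => y; set h := fun q => cmap d q 0 j => sh.
  split=> [|v ty]; first exact: ((sPhi y).2 h).
  have [u tu ->] := frame v y ty.
  rewrite linv_fieldE; last exact: ((sPhi y).2 h).
  pose b := Phi y.
  (* Since [Phi (y * s)] is the conjugate of [b = Phi y] by [s], the derivative along [u] is the
     left-invariant field of [u] at [b] minus the right-invariant one, and these agree by
     hypothesis. *)
  have -> : (fun s => cmap d (Phi (y * s)%g) 0 j) = (fun s =>
    h (s^-1 * (b * s))%g).
    by apply/funext => s; rewrite /h /b /Phi invgM !mulgA.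
  have sb : smooth_at A (1^-1 * ltrans b 1)%g h.
    by rewrite /ltrans invg1 mul1g mulg1.
  have := tvec_pair manA manA manA (lie_inv lieG 1%g) (smooth_ltrans b 1%g)
    (smooth_at_mul sb) tu; rewrite /= /ltrans => ->.
  have shb : smooth_at A 1%g (fun s => h (s * b)%g).
    by apply: (smooth_rtrans b 1%g).2; rewrite /rtrans mul1g.
  have -> : u (fun s => h (s^-1 * (b * 1))%g) = - u (fun s => h (s * b)%g).
    by rewrite mulg1; exact: (tvec_inv tu shb).
  have -> : u (fun s => h (1^-1 * (b * s))%g) = u (fun s => h (b * s)%g).
    by congr u; apply/funext => s; rewrite invg1 mul1g.
  by rewrite -rinv_fieldE// rl// linv_fieldE// addNr.
have cx : \forall y \near x, cdom d (Phi y).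
  exact: (near_map (sPhi x) (near_cdom manA Ad dx)).
have co : \forall y \near x, forall j : 'I_m,
  cmap d (Phi y) 0 j = cmap d (Phi x) 0 j.
  exact: (@filter_forall _ _ (fun (j : 'I_m) (y : G) =>
    cmap d (Phi y) 0 j = cmap d (Phi x) 0 j) (nbhs x) _ coP).
near=> y; rewrite -[LHS](man_cmapK manA Ad); last by near: y.
rewrite -[RHS](man_cmapK manA Ad dx); congr cinv; apply/rowP => j.
by move: j; near: y.
Unshelve. all: by end_near. Qed.

End LieGroupFields.

(* A frame on [D] over which bracket, complex structure and metric have constant
   coefficients; [E u] is the field with constant coordinates [u]. *)
Record invariant_frame (R : realType) (m : nat) (M : topologicalType)
    (A : set (chart R m M)) (J : endo_field (R := R) (M := M))
    (g : bilinear_field (R := R) (M := M)) (D : set M)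
    (E : 'rV[R]_m -> vfield R M) (gV : 'rV[R]_m -> 'rV[R]_m -> R)
    (JV : 'rV[R]_m -> 'rV[R]_m) (bV : 'rV[R]_m -> 'rV[R]_m -> 'rV[R]_m) : Prop
      :=
  InvariantFrame {
  fr_linear : forall a u v x, E (a *: u + v) x = a *: E u x + E v x;
  fr_smooth : forall u x, D x -> smooth_field_at A x (E u);
  fr_metric : forall u v x, D x -> g x (E u x) (E v x) = gV u v;
  fr_endo : forall u x, D x -> J x (E u x) = E (JV u) x;
  fr_bracket : forall u v x, D x -> bracket A (E u) (E v) x = E (bV u v) x }.

(** * Left-invariant frames and structure constants *)

Section LieGroupFrame.
Context {R : realType} {m : nat} {G : groupSpaceType}.
Variables (A : set (chart R m G)) (J : endo_field (R := R) (M := G)) (g :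
  bilinear_field (R := R) (M := G)).
Hypotheses (lieG : is_lie_group A) (hermG : is_hermitian A J g).
Hypotheses (invJ : left_invariant_endo A J) (invg : left_invariant_metric A g).
Let manA : is_manifold A := lie_manifold lieG.
Local Notation one := (1%g : G).
Local Notation V := 'rV[R]_m.

Definition linv_frame c (u : V) : vfield R G := linv_field A (chart_vec A c
  one u).

Variable c : chart R m G.
Hypotheses (Ac : A c) (c1 : cdom c one).
Local Notation E := (linv_frame c).

Let te u : tangent A one (chart_vec A c one u).
Proof. exact: chart_vec_tangent. Qed.

Let El a u v x : E (a *: u + v) x = a *: E u x + E v x.
Proof. by rewrite /linv_frame chart_vec_linear// linv_field_linear. Qed.

Let ED u v x : E (u + v) x = E u x + E v x.
Proof. by have := El 1 u v x; rewrite !scale1r. Qed.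

Let E0 x : E 0 x = 0.
Proof.
by have /eqP := ED 0 0 x; rewrite addr0 eq_sym -subr_eq0 addrK => /eqP.
Qed.

Let EZ a u x : E (a *: u) x = a *: E u x.
Proof. by have := El a u 0 x; rewrite !addr0 E0 addr0. Qed.

Let EN u x : E (- u) x = - E u x.
Proof. by rewrite -scaleN1r EZ scaleN1r. Qed.

Let Et u x : tangent A x (E u x).
Proof. exact: linv_field_tangent. Qed.

Let E0_inj u x : E u x = 0 -> u = 0.
Proof.
move=> /(linv_field_inj lieG (te u)) u0; apply/rowP => j.
by rewrite -(chart_vec_coord manA u j Ac c1) u0 mxE.
Qed.

Let E_inj u v x : E u x = E v x -> u = v.
Proof.
move=> uv; apply/eqP; rewrite -subr_eq0; apply/eqP/(@E0_inj _ x).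
by rewrite ED EN uv subrr.
Qed.

Lemma linv_frame_span x v : tangent A x v -> exists u, v = E u x.
Proof.
apply: (tangent_frame manA (L := fun u => E u x)) => // u.
exact: E0_inj.
Qed.

Let Epush u a x : E u (a * x)%g = Defs.pushforward A (ltrans a) x (E u x).
Proof. exact: linv_field_pushforward. Qed.

Let Epush1 u x : E u x = Defs.pushforward A (ltrans x) one (E u one).
Proof. by rewrite -Epush mulg1. Qed.

Lemma linv_frame_smooth u x : smooth_field_at A x (E u).
Proof. exact: linv_field_smooth. Qed.

(** [JV] and [bV] are read off at the identity and left invariance carries them to every point.
    Their algebraic identities are those of the fields, because [E] is injective at a point. *)
Lemma linv_frameP : exists gV JV bV,
  [/\ inner_product gV, compatible_endo gV JV, integrable_bracket JV bV &
      invariant_frame A J g setT E gV JV bV].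
Proof.
have [_ cJ rg gJ] := hermG.
have /choice[JV JVP] : forall u : V, exists z : V, J one (E u one) = E z one.
  by move=> u; apply: linv_frame_span; exact: (cs_tangent cJ).
have /choice[bV bVP] : forall uv : V * V, exists z : V,
    bracket A (E uv.1) (E uv.2) one = E z one.
  move=> uv; apply: linv_frame_span.
  exact: (tangent_bracket manA (linv_frame_smooth _ _) (linv_frame_smooth _ _)).
pose gV u v := g one (E u one) (E v one).
have JE u (x : G) : J x (E u x) = E (JV u) x.
  have := invJ x (Et u one); rewrite mulg1 -!Epush1 => ->.
  by rewrite JVP -Epush1.
have appJE u : appJ J (E u) = E (JV u) by apply/funext => x; exact: JE.
have gE u v (x : G) : g x (E u x) (E v x) = gV u v.
  by have := invg x (Et u one) (Et v one); rewrite mulg1 -!Epush1.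
have bE u v (x : G) : bracket A (E u) (E v) x = E (bV (u, v)) x.
  have := linv_field_bracket lieG x one (te u) (te v); rewrite mulg1 => ->.
  by rewrite (bVP (u, v)) -Epush1.
have JVl a u v : JV (a *: u + v) = a *: JV u + JV v.
  apply: (@E_inj _ _ one); rewrite -JE !El (cs_linear cJ)// ?JE//.
exists gV, JV, (fun u v => bV (u, v)); split; last first.
- by split=> // u x _; exact: linv_frame_smooth.
- split=> [a u v w|u v|u v].
  + apply: (@E_inj _ _ one); rewrite -bE El -!bE.
    rewrite bracket_skew (bracket_skew _ (E u)) (bracket_skew _ (E v)).
    have -> : E (a *: u + v) = (fun x => cst a x *: E u x) + E v.
      by apply/funext => x; rewrite El.
    have sw := linv_frame_smooth w one; have su := linv_frame_smooth u one.
    have sau : smooth_field_at A one (fun x => cst a x *: E u x).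
      by apply: smooth_fieldZ => //; exact: smooth_at_cst.
    rewrite (bracketDr sw sau (linv_frame_smooth v one)).
    rewrite (bracketZr manA sw su); last exact: smooth_at_cst.
    rewrite (tvec_cst _ (Et w one)) scale0r add0r opprD /cst.
    by rewrite scalerN.
  + by apply: (@E_inj _ _ one); rewrite EN -!bE bracket_skew.
  + have := cs_integrable cJ (linv_frame_smooth u one) (linv_frame_smooth v
    one).
    rewrite !appJE !bE !JE -!EN -!ED => /E0_inj //.
- split=> // [u|u v].
    apply: (@E_inj _ _ one); rewrite EN -!JE (cs_square cJ)//.
  by rewrite /gV -!JE gJ.
- split=> [a u v w|u v|v v0].
  + by rewrite /gV El (rm_linear rg).
  + by rewrite /gV (rm_sym rg).
  + by apply: (rm_pos rg) => // /E0_inj.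
Qed.

Fixpoint J_ascending (JV : V -> V) (bV : V -> V -> V) (k : nat) : set V :=
  if k is k'.+1 then [set u | forall w,
      J_ascending JV bV k' (bV u w) /\ J_ascending JV bV k' (bV (JV u) w)]
  else [set 0].

(** The ascending series is rebuilt on coordinate vectors, where it is visibly made of subspaces.
    Exhaustion follows by testing membership of [E u] in [J_series] against the fields [E w]. *)
Lemma J_ascending_flag gV JV bV : nilpotent_complex_structure A J ->
    inner_product gV -> compatible_endo gV JV -> integrable_bracket JV bV ->
    invariant_frame A J g setT E gV JV bV ->
  exists k, J_flag JV bV (J_ascending JV bV) k.
Proof.
move=> [k nilJ] gP JP bP fr; exists k.
have lin j : J_ascending JV bV j 0 /\ forall a u v,
    J_ascending JV bV j u -> J_ascending JV bV j v ->
    J_ascending JV bV j (a *: u + v).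
  elim: j => [|j [IH0 IHD]] /=.
    by split=> // a u v -> ->; rewrite scaler0 addr0.
  split=> [w|a u v Hu Hv w]; first by rewrite (ce0 JP) (ib0l bP).
  have [[h1 h2] [h3 h4]] := (Hu w, Hv w).
  by rewrite (ce_linear JP) !(ib_linear bP); split; exact: IHD.
have opp j u : J_ascending JV bV j u -> J_ascending JV bV j (- u).
  by move=> Hu; rewrite -scaleN1r -[_ *: _]addr0; apply: (lin j).2 => //;
    exact: (lin j).1.
split=> // [j u|j u v|u].
- elim: j u => [|j IH] u /=.
    by move=> ->; rewrite (ce0 JP); split=> // w; rewrite !(ce0 JP, ib0l bP).
  move=> Hu; split=> w; have [h1 h2] := Hu w.
    by split=> //; rewrite (ce_square JP) (ibNl bP); exact: opp.
  by split; [exact: (IH _ h1).2|exact: (IH _ h2).2].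
- by move=> /(_ v)[].
have : J_series A J k (E u) by apply: nilJ; exact: linv_field_invariant.
elim: k u {nilJ} => [|k IH] u /=.
  by move=> Eu0; apply: (@E0_inj _ one); rewrite Eu0.
have bE v w : bracket A (E v) (E w) = E (bV v w).
  by apply/funext => x; exact: (fr_bracket fr).
have JE v : appJ J (E v) = E (JV v) by apply/funext => x; exact: (fr_endo fr).
move=> [_ Hu] w; have [] := Hu (E w) (linv_field_invariant lieG (te w)).
by rewrite JE !bE => /IH h1 /IH h2.
Qed.

Lemma abelian_commutative gV JV bV : simply_connected (R := R) G ->
    inner_product gV -> invariant_frame A J g setT E gV JV bV ->
    (forall u v, bV u v = 0) ->
  forall x y : G, (x * y)%g = (y * x)%g.
Proof.
move=> scG gP fr b0.
apply: (rinv_linv_commutative lieG scG) => [v x /linv_frame_span[u ->]|w x tw].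
  by exists (chart_vec A c one u).
have [_ _ rg _] := hermG.
have [k [e [eP _ eE]]] := orthonormal_basis gP (S := setT) I (fun _ _ _ _ _ =>
  I).
have {}eE v : v = \sum_i gV v (e i) *: e i by exact: eE.
have Esum (a : 'I_k -> R) y : E (\sum_i a i *: e i) y = \sum_i a i *: E (e i) y.
  rewrite (big_morph (fun u => E u y) (id1 := 0) (op1 := +%R)) //.
  by apply: eq_bigr => i _; rewrite EZ.
have gEe v y : tangent A y v -> v = \sum_i g y v (E (e i) y) *: E (e i) y.
  move=> /linv_frame_span[u ->]; rewrite {1}(eE u) Esum.
  by apply: eq_bigr => l _; rewrite (fr_metric fr).
(* Coefficients are taken with the metric, so that their smoothness comes from that of [g]. *)
pose al i y := g y (rinv_field A w y) (E (e i) y).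
have sr y : smooth_field_at A y (rinv_field A w) by exact: rinv_field_smooth.
have sal i y : smooth_at A y (al i).
  by apply: (rm_smooth rg) => //; exact: linv_frame_smooth.
have rE : rinv_field A w = \sum_i (fun y => al i y *: E (e i) y).
  apply/funext => y; rewrite fct_sumE; apply: gEe.
  exact: rinv_field_tangent.
(* The bracket of [E u] with the right-invariant field is 0; as the frame fields commute, it reduces
   to the derivatives of the coefficients along [E u]. *)
have al0 i y v : tangent A y v -> v (al i) = 0.
  move=> /linv_frame_span[u ->].
  have := linv_rinv_bracket lieG y (te u) tw; rewrite rE (bracket_sumr manA);
    last 2 first.
  - exact: linv_frame_smooth.
  - move=> l; apply: smooth_fieldZ => //; exact: linv_frame_smooth.
  under eq_bigr => l _.
    rewrite (bracketZr manA)//; try exact: linv_frame_smooth.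
    rewrite (fr_bracket fr)// b0 E0 scaler0 addr0; over.
  rewrite -Esum -[X in _ = X](E0 y) => /E_inj h.
  have := congr1 (gV^~ (e i)) h; rewrite (ip0l gP) (ip_suml gP) (bigD1 i)//=.
  rewrite (ipZl gP) eP eqxx mulr1 big1 ?addr0// => l li.
  by rewrite (ipZl gP) eP (negbTE li) mulr0.
have alc i y : al i y = al i one.
  apply: (locally_constant_path_connected (F := al i) scG) => z.
  apply: (smooth_locally_constant manA); near=> q.
  by split=> [|v tv]; [exact: sal|exact: (al0 _ _ _ tv)].
have [u wE] : exists u, w = E u one by exact: linv_frame_span.
have -> : linv_field A w x = E u x.
  by rewrite {1}wE /linv_frame (linv_field1 lieG (te u)).
rewrite rE fct_sumE; under eq_bigr do rewrite alc.
rewrite -Esum; congr (E _ x); rewrite [RHS]eE; apply: eq_bigr => i _.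
by rewrite /al (rinv_field1 lieG tw) wE (fr_metric fr).
Unshelve. all: by end_near. Qed.

End LieGroupFrame.

(** * The Strominger connection in an invariant frame *)

Section LocalFrame.
Context {R : realType} {m : nat} {M : topologicalType}.
Variables (A : set (chart R m M)) (J : endo_field (R := R) (M := M)).
Variables (g : bilinear_field (R := R) (M := M)) (D : covariant_op (R := R) (M
  := M)).
Hypotheses (herm : is_hermitian A J g) (strom : is_strominger A J g D).
Local Notation V := 'rV[R]_m.
Variables (U : set M) (E : V -> vfield R M).
Variables (gV : V -> V -> R) (JV : V -> V) (bV : V -> V -> V).
Hypotheses (oU : open U) (fr : invariant_frame A J g U E gV JV bV).
Hypotheses (gP : inner_product gV) (JP : compatible_endo gV JV).
Hypothesis bP : integrable_bracket JV bV.

Let manA : is_manifold A := herm_manifold herm.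
Let rg : is_riemannian A g := herm_riemannian herm.
Let cD : is_connection A D := st_connection strom.

Let ED u v x : E (u + v) x = E u x + E v x.
Proof. by have := fr_linear fr 1 u v x; rewrite !scale1r. Qed.

Let E0 x : E 0 x = 0.
Proof.
by have /eqP := ED 0 0 x; rewrite addr0 eq_sym -subr_eq0 addrK => /eqP.
Qed.

Let EZ a u x : E (a *: u) x = a *: E u x.
Proof. by have := fr_linear fr a u 0 x; rewrite !addr0 E0 addr0. Qed.

Let EN u x : E (- u) x = - E u x.
Proof. by rewrite -scaleN1r EZ scaleN1r. Qed.

Let EB u v x : E (u - v) x = E u x - E v x.
Proof. by rewrite ED EN. Qed.

Let nearU x : U x -> \forall y \near x, U y.
Proof. by move=> Ux; apply: open_nbhs_nbhs. Qed.

Let Et u x : U x -> tangent A x (E u x).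
Proof. by move=> Ux; apply: smooth_field_tangent; exact: (fr_smooth fr). Qed.

Let E0_inj u x : U x -> E u x = 0 -> u = 0.
Proof.
move=> Ux Eu0; apply: (ip_eq0 gP); rewrite -(fr_metric fr u u Ux) Eu0.
have := rm_linear rg 1 (tangent0 manA x) (tangent0 manA x) (tangent0 manA x).
by rewrite scaler0 addr0 mul1r => /eqP; rewrite eq_sym -subr_eq0 addrK => /eqP.
Qed.

Let E_inj u v x : U x -> E u x = E v x -> u = v.
Proof.
move=> Ux uv; apply/eqP; rewrite -subr_eq0; apply/eqP/(E0_inj Ux).
by rewrite EB uv subrr.
Qed.

Lemma frame_span x v : U x -> tangent A x v -> exists u, v = E u x.
Proof.
move=> Ux; apply: (tangent_frame manA (L := fun u => E u x)) => [a u w|u|u].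
- exact: (fr_linear fr).
- exact: Et.
- exact: E0_inj.
Qed.

Variables (k : nat) (e : 'I_k -> V).
Hypothesis eP : forall i j, gV (e i) (e j) = (i == j)%:R.
Hypothesis eE : forall x, x = \sum_i gV x (e i) *: e i.

Let E_sum (a : 'I_k -> R) x : E (\sum_i a i *: e i) x = \sum_i a i *: E (e i) x.
Proof.
rewrite (big_morph (fun u => E u x) (id1 := 0) (op1 := +%R)) //.
by apply: eq_bigr => i _; rewrite EZ.
Qed.

Let D_frame_ex u w x : U x -> exists z, D x (E u x) (E w) = E z x.
Proof.
move=> Ux; apply: frame_span => //.
by apply: (conn_tangent cD); [exact: Et|exact: (fr_smooth fr)].
Qed.

(** At a fixed point the coefficients of [D] satisfy the conditions of [strominger3_unique].
    Skewness in the last two arguments holds because [g] is constant on frame fields near [x]. *)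
Lemma strominger_frame u w x : U x ->
  D x (E u x) (E w) = E (strominger gV JV e bV u w) x.
Proof.
move=> Ux; pose gam u w t := g x (D x (E u x) (E w)) (E t x).
have gamE u' w' z : D x (E u' x) (E w') = E z x ->
    forall t, gam u' w' t = gV z t.
  by move=> DE t; rewrite /gam DE (fr_metric fr).
have [z DE] := D_frame_ex u w Ux.
rewrite DE; congr (E _ x); apply: (ip_inj gP) => t.
rewrite (stromingerE gP JP eE bP) -(gamE _ _ _ DE); clear z DE.
have tD u' w' : tangent A x (D x (E u' x) (E w')).
  by apply: (conn_tangent cD); [exact: Et|exact: (fr_smooth fr)].
apply: (strominger3_unique gP JP bP (gam := gam)) => {u w t} u w t.
- by have [z /gamE h] := D_frame_ex u w Ux; rewrite !h (ipNr gP).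
- have := st_metric strom (Et u Ux) (fr_smooth fr w Ux) (fr_smooth fr t Ux).
  rewrite (tvec_eq manA (Et u Ux) (h := cst (gV w t))); last first.
    by move: (nearU Ux); apply: filterS => y Uy; rewrite (fr_metric fr).
  rewrite (tvec_cst _ (Et u Ux)) => /esym/eqP; rewrite addr_eq0 => /eqP.
  by rewrite /gam => ->; rewrite (rm_sym rg)//; exact: Et.
- rewrite /gam.
  have -> : D x (E u x) (E (JV w)) = J x (D x (E u x) (E w)).
    rewrite -(st_complex strom (Et u Ux) (fr_smooth fr w Ux)).
    apply: (conn_local cD); [exact: Et|exact: (fr_smooth fr)| |].
      apply: (cs_smooth (herm_complex herm)); exact: (fr_smooth fr).
    by move: (nearU Ux); apply: filterS => y Uy; rewrite /appJ (fr_endo fr).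
  have [z ->] := D_frame_ex u w Ux.
  rewrite (fr_endo fr)// !(fr_metric fr)//; exact: (ce_adjoint gP JP).
- have := st_torsion_skew strom (fr_smooth fr u Ux) (fr_smooth fr w Ux)
  (fr_smooth fr t Ux).
  have [[z1 h1] [z2 h2]] := (D_frame_ex u w Ux, D_frame_ex w u Ux).
  have [[z3 h3] [z4 h4]] := (D_frame_ex u t Ux, D_frame_ex t u Ux).
  rewrite /torsion !(fr_bracket fr)// (gamE _ _ _ h1) (gamE _ _ _ h2).
  rewrite (gamE _ _ _ h3) (gamE _ _ _ h4) h1 h2 h3 h4.
  by rewrite -!EB !(fr_metric fr)// !(ipBl gP).
Qed.

Local Notation G := (strominger gV JV e bV).

Definition frame_curvature u w z : V := G u (G w z) - G w (G u z) - G (bV u w)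
  z.

Lemma curvature_frame u w z x : U x ->
  curvature A D (E u) (E w) (E z) x = E (frame_curvature u w z) x.
Proof.
move=> Ux; have DDE u' w' : D x (E u' x) (fun q => D q (E w' q) (E z)) =
    E (G u' (G w' z)) x.
  rewrite -strominger_frame//; apply: (conn_local cD); [exact: Et| | |].
  - by apply: (conn_smooth cD); exact: (fr_smooth fr).
  - exact: (fr_smooth fr).
  - by move: (nearU Ux); apply: filterS => y Uy; rewrite strominger_frame.
by rewrite /curvature !DDE (fr_bracket fr)// strominger_frame// -!EB.
Qed.

Let R4 u w z t := gV (frame_curvature u w z) t.

Let bNl u w : bV (- u) w = - bV u w. Proof. exact: (ibNl bP). Qed.

Let GNl u w : G (- u) w = - G u w.
Proof.
have h0 : G 0 w = 0.
  have /eqP := strominger_linearl gP JP eE bP 1 0 0 w.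
  by rewrite scaler0 addr0 scale1r eq_sym -subr_eq0 addrK => /eqP.
have := strominger_linearl gP JP eE bP (-1) u 0 w.
by rewrite !addr0 !scaleN1r h0 addr0.
Qed.

Let GNr u w : G u (- w) = - G u w.
Proof.
have h0 : G u 0 = 0.
  have /eqP := strominger_linearr gP JP eE bP 1 0 0 u.
  by rewrite scaler0 addr0 scale1r eq_sym -subr_eq0 addrK => /eqP.
have := strominger_linearr gP JP eE bP (-1) w 0 u.
by rewrite !addr0 !scaleN1r h0 addr0.
Qed.

Let R4C u w z t : R4 u w z t = - R4 w u z t.
Proof.
rewrite /R4 /frame_curvature (ib_skew bP u w) GNl !(ipBl gP) (ipNl gP); ring.
Qed.

Let R4N u w z t : R4 (- u) w z t = - R4 u w z t.
Proof.
rewrite /R4 /frame_curvature bNl !GNl GNr !(ipBl gP) !(ipNl gP); ring.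
Qed.

Let R4N3 u w z t : R4 u w (- z) t = - R4 u w z t.
Proof.
rewrite /R4 /frame_curvature !GNr !(ipBl gP) !(ipNl gP); ring.
Qed.

Let R4D u w z t : R4 u w z t = - R4 u w t z.
Proof.
rewrite /R4 /frame_curvature !(ipBl gP).
have met := strominger_metric gP JP eE bP.
rewrite (met u (G w z)) (met w (G u z)) (met (bV u w) z) (met u (G w t)) (met
  w (G u t)).
rewrite (ip_sym gP (G w t)) (ip_sym gP (G u t)) (ip_sym gP (G (bV u w) t));
  ring.
Qed.

Let R4_diag12 u z t : R4 u u z t = 0.
Proof. by have := R4C u u z t; lra. Qed.

Let R4_diag34 u w z : R4 u w z z = 0.
Proof. by have := R4D u w z z; lra. Qed.

(** The pair encodes [X = x - i J x]. Then the squared norm of [X] is twice that of [x], and the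
    curvature on [X] and its conjugate is [4 R(x, Jx, Jx, x)], so the factors cancel. Of the sixteen
    terms, those repeating a vector within a skew pair vanish. *)
Lemma hol_sect_curv_frame u x : U x -> u <> 0 ->
  hol_sect_curv A g D x (E u, E (- JV u)) =
  (hol_curv gV JV e bV u / gV u u ^+ 2)%:C%C.
Proof.
move=> Ux u0; have u1 : gV u u != 0 by rewrite gt_eqF// (ip_gt0 gP).
have conjE : cconj (E u, E (- JV u)) = (E u, E (JV u)).
  congr pair; apply/funext => q.
  by have -> : (- E (- JV u)) q = - (E (- JV u) q) by []; rewrite EN opprK.
have gE : cmetric g x (E u, E (- JV u)) (E u, E (JV u)) = (2 * gV u u)%:C%C.
  rewrite /cmetric /complexify2 !big_bool /= !(addn0, add0n, addn1).
  rewrite !(fr_metric fr)// !(ipNl gP) (ce_isometry JP) (ip_sym gP (JV u)).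
  apply/eqP; rewrite !exprS expr0 eq_complex /=; apply/andP; split; apply/eqP;
    ring.
have RE u1' u2 u3 u4 : g x (curvature A D (E u1') (E u2) (E u3) x) (E u4 x) =
  R4 u1' u2 u3 u4.
  by rewrite curvature_frame// (fr_metric fr).
have cE : ccurvature4 A g D x (E u, E (- JV u)) (E u, E (JV u)) (E u,
  E (- JV u))
    (E u, E (JV u)) = (4 * hol_curv gV JV e bV u)%:C%C.
  rewrite /ccurvature4 /complexify4 !big_bool /= !(addn0, add0n, addn1) !RE.
  rewrite (hol_curvE gP JP eE bP) -/(frame_curvature _ _ _) -/(R4 _ _ _ _).
  rewrite !(R4N, R4N3) !(R4_diag12, R4_diag34) (R4C (JV u) u).
  rewrite !(R4D _ _ (JV u) u) (R4C (JV u) u).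
  apply/eqP; rewrite !exprS expr0 eq_complex /=; apply/andP; split; apply/eqP;
    ring.
rewrite /hol_sect_curv conjE gE cE -rmorphXn -fmorph_div; congr (_%:C)%C.
by field.
Qed.

(** * Commuting frames: torsion and curvature vanish *)

Section Abelian.
Hypothesis b0 : forall u v, bV u v = 0.

Let co i (Y : vfield R M) : M -> R := fun y => g y (Y y) (E (e i) y).

Let co_smooth i Y x : U x -> smooth_field_at A x Y -> smooth_at A x (co i Y).
Proof. by move=> Ux sY; apply: (rm_smooth rg) => //; exact: (fr_smooth fr). Qed.

Let co_tangent x v : U x -> tangent A x v ->
  v = \sum_i g x v (E (e i) x) *: E (e i) x.
Proof.
move=> Ux /(frame_span Ux)[u ->]; rewrite {1}(eE u) E_sum.
by apply: eq_bigr => i _; rewrite (fr_metric fr).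
Qed.

Let co_expand Y x : U x -> smooth_field_at A x Y ->
  \forall y \near x, Y y = (\sum_i (fun y => co i Y y *: E (e i) y)) y.
Proof.
move=> Ux [tY _]; near=> y; rewrite fct_sumE; apply: co_tangent.
  by near: y; exact: nearU.
by near: y.
Unshelve. all: by end_near. Qed.

Let strominger0 u w : G u w = 0.
Proof.
apply: (ip_inj gP) => t; rewrite (stromingerE gP JP eE bP) /strominger3 !b0.
by rewrite !(ip0l gP) !subr0 !addr0 mulr0.
Qed.

Let D_frame0 x v w : U x -> tangent A x v -> D x v (E w) = 0.
Proof.
by move=> Ux /(frame_span Ux)[u ->]; rewrite strominger_frame// strominger0 E0.
Qed.

Let smooth_coE i Y x : U x -> smooth_field_at A x Y ->
  smooth_field_at A x (fun y => co i Y y *: E (e i) y).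
Proof.
by move=> Ux sY; apply: (smooth_fieldZ manA);
  [exact: co_smooth|exact: (fr_smooth fr)].
Qed.

Let D_expand x v Y : U x -> tangent A x v -> smooth_field_at A x Y ->
  D x v Y = \sum_i v (co i Y) *: E (e i) x.
Proof.
move=> Ux tv sY.
have Dsum n (Z : 'I_n -> vfield R M) : (forall i, smooth_field_at A x (Z i)) ->
    D x v (\sum_i Z i) = \sum_i D x v (Z i).
  elim: n Z => [|n IH] Z sZ.
    rewrite !big_ord0; have := conn_add cD tv (smooth_field0 manA x)
      (smooth_field0 manA x).
    by rewrite addr0 => /eqP; rewrite eq_sym -subr_eq0 addrK => /eqP.
  rewrite !big_ord_recl (conn_add cD tv)//; last first.
    by apply: (smooth_field_sum manA) => i; exact: sZ.
  by rewrite IH// => i; exact: sZ.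
have sE : smooth_field_at A x (\sum_i (fun y => co i Y y *: E (e i) y)).
  by apply: (smooth_field_sum manA) => i; exact: smooth_coE.
rewrite (conn_local cD tv sY sE (co_expand Ux sY)) Dsum; last first.
  by move=> i; exact: smooth_coE.
apply: eq_bigr => i _; rewrite (conn_leibniz cD tv) ?D_frame0//.
- by rewrite scaler0 addr0.
- exact: co_smooth.
- exact: (fr_smooth fr).
Qed.

(** The frame is parallel and commuting, so covariant derivative and bracket both merely
    differentiate coefficients: the bracket has components [X (Y^i) - Y (X^i)]. *)
Lemma torsion_abelian_frame x X Y : U x ->
  smooth_field_at A x X -> smooth_field_at A x Y -> torsion A D X Y x = 0.
Proof.
move=> Ux sX sY.
have [tX tY] := (smooth_field_tangent sX, smooth_field_tangent sY).
have br Z W : smooth_field_at A x Z -> smooth_field_at A x W ->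
    bracket A Z W x = \sum_i (Z x (co i W) *: E (e i) x
                             + co i W x *: bracket A Z (E (e i)) x).
  move=> sZ sW; have tZ := smooth_field_tangent sZ.
  rewrite (bracket_eqr manA tZ (co_expand Ux sW)) (bracket_sumr manA sZ);
    last first.
    by move=> i; exact: smooth_coE.
  apply: eq_bigr => i _; rewrite (bracketZr manA)//;
    first exact: (fr_smooth fr).
  exact: co_smooth.
have brE i : bracket A X (E (e i)) x = - \sum_j E (e i) x (co j X) *: E (e j) x.
  rewrite bracket_skew br//; last exact: (fr_smooth fr).
  congr (- _); apply: eq_bigr => j _.
  by rewrite (fr_bracket fr)// b0 E0 scaler0 addr0.
rewrite /torsion !D_expand// br// big_split /=.
have -> : \sum_i co i Y x *: bracket A X (E (e i)) x =
    - \sum_j Y x (co j X) *: E (e j) x.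
  under eq_bigr => i _ do rewrite brE scalerN scaler_sumr.
  rewrite sumrN exchange_big /=; congr (- _); apply: eq_bigr => j _.
  under eq_bigr => i _ do rewrite scalerA.
  rewrite -scaler_suml; congr (_ *: _).
  by rewrite [in RHS](co_tangent Ux tY) fct_sumE.
by rewrite subrr.
Qed.

(** On each coefficient of [Z] the curvature acts as [X Y - Y X - [X, Y]], which is 0 by the
    definition of the bracket. *)
Lemma curvature_abelian_frame x X Y Z : U x ->
    smooth_field_at A x X -> smooth_field_at A x Y -> smooth_field_at A x Z ->
  curvature A D X Y Z x = 0.
Proof.
move=> Ux sX sY sZ.
have DD W W' : smooth_field_at A x W -> smooth_field_at A x W' ->
    D x (W x) (fun q => D q (W' q) Z) =
    \sum_i W x (fun q => W' q (co i Z)) *: E (e i) x.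
  move=> sW sW'; have tW := smooth_field_tangent sW.
  have sc i : smooth_at A x (fun q => W' q (co i Z)).
    by have [_] := sW'; apply; exact: co_smooth.
  have nearD : \forall q \near x, D q (W' q) Z =
      (\sum_i (fun q => W' q (co i Z) *: E (e i) q)) q.
    near=> q; rewrite fct_sumE; apply: D_expand.
    - by near: q; exact: nearU.
    - by near: q; exact: sW'.1.
    (* Smoothness of [Z] at [x] only tests functions smooth at [x], so smoothness at the nearby [q]
       is recovered from the expansion in the frame, whose coefficients are smooth near [x]. *)
    - have Zq : \forall y \near q, (\sum_i (fun y =>
      co i Z y *: E (e i) y)) y = Z y.
        near: q; apply: near_join; move: (co_expand Ux sZ).
        by apply: filterS => y ->.
      have sq : forall i, smooth_at A q (co i Z).
        near: q; apply: (@filter_forall _ _ (fun i q =>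
          smooth_at A q (co i Z)) (nbhs x)).
        by move=> i; apply: (smooth_at_near manA); exact: co_smooth.
      apply: (smooth_field_eq manA Zq); apply: (smooth_field_sum manA) => i.
      apply: (smooth_fieldZ manA); last first.
        by apply: (fr_smooth fr); near: q; exact: nearU.
      exact: sq.
  have sS : smooth_field_at A x (\sum_i (fun q => W' q (co i Z) *: E (e i) q)).
    apply: (smooth_field_sum manA) => i.
    by apply: (smooth_fieldZ manA) => //; exact: (fr_smooth fr).
  rewrite (conn_local cD tW (conn_smooth cD sW' sZ) sS nearD) D_expand//.
  apply: eq_bigr => i _; congr (_ *: _); apply: (tvec_eq manA tW).
  near=> q; have Uq : U q by near: q; exact: nearU.
  rewrite /co fct_sumE.
  have -> : \sum_(l < k) W' q (co l Z) *: E (e l) q =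
      E (\sum_l W' q (co l Z) *: e l) q by rewrite E_sum.
  rewrite (fr_metric fr)// (ip_suml gP) (bigD1 i)//= (ipZl gP) eP eqxx mulr1.
  rewrite big1 ?addr0// => l li.
  by rewrite (ipZl gP) eP (negbTE li) mulr0.
have tb : tangent A x (bracket A X Y x) by exact: (tangent_bracket manA).
rewrite /curvature !DD// (D_expand Ux tb sZ) -!sumrB; apply: big1 => i _.
rewrite -!scalerBl bracketE; last exact: co_smooth.
by rewrite subrr scale0r.
Unshelve. all: by end_near. Qed.

End Abelian.

End LocalFrame.

(** With every bracket replaced by [D_X Y - D_Y X], the exterior derivative becomes an alternating
    sum of covariant derivatives of the Kähler form, and these vanish because [g] and [J] are
    parallel. *)
Lemma strominger_torsion_free_kahler (R : realType) (m : nat) (M :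
  topologicalType)
    (A : set (chart R m M)) (J : endo_field) (g : bilinear_field) (D :
      covariant_op) :
    is_hermitian A J g -> is_strominger A J g D ->
    (forall p X Y, smooth_field_at A p X -> smooth_field_at A p Y ->
       torsion A D X Y p = 0) ->
  is_kahler A J g.
Proof.
move=> [manA cJ rg gJ] [cD met DJ _] tor p X Y Z sX sY sZ.
have [[tX tY] tZ] := (smooth_field_tangent sX, smooth_field_tangent sY,
  smooth_field_tangent sZ).
have tJ v : tangent A p v -> tangent A p (J p v) by exact: (cs_tangent cJ).
have tD v W : tangent A p v -> smooth_field_at A p W -> tangent A p (D p v W).
  exact: (conn_tangent cD).
have Jskew v w : tangent A p v -> tangent A p w -> g p (J p v) w = - g p (J p
  w) v.
  move=> tv tw; rewrite (rm_sym rg (tJ _ tw) tv) -(gJ p (J p v) w (tJ _ tv) tw).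
  rewrite (cs_square cJ)//; have := rm_linear rg (-1) tv (tangent0 manA p) (tJ
    _ tw).
  have := rm_linear rg 1 (tangent0 manA p) (tangent0 manA p) (tJ _ tw).
  rewrite scaler0 !addr0 scaleN1r; lra.
have gB u v w : tangent A p u -> tangent A p v -> tangent A p w ->
    g p (J p (u - v)) w = g p (J p u) w - g p (J p v) w.
  move=> tu tv tw; rewrite -[u - v]addrC -scaleN1r (cs_linear cJ)//.
  by rewrite (rm_linear rg)//; [ring|exact: tJ|exact: tJ].
have dw v W W' : tangent A p v -> smooth_field_at A p W -> smooth_field_at A p
  W' ->
    v (fun q => kahler_form J g q (W q) (W' q)) =
    g p (J p (D p v W)) (W' p) - g p (J p (D p v W')) (W p).
  move=> tv sW sW'; have sJW := cs_smooth cJ sW.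
  have := met p v _ _ tv sJW sW'; rewrite /appJ /kahler_form => ->.
  rewrite -/(appJ J W) DJ//; congr (_ + _).
  by rewrite Jskew//; [exact: smooth_field_tangent|exact: tD].
have br W W' : smooth_field_at A p W -> smooth_field_at A p W' ->
    bracket A W W' p = D p (W p) W' - D p (W' p) W.
  move=> sW sW'; have /eqP := tor p W W' sW sW'.
  by rewrite /torsion subr_eq0 => /eqP ->.
rewrite /ext_deriv2 !dw// !br// /kahler_form !gB//; try exact: tD.
ring.
Qed.

(** * Frames pushed down through the covering *)

Section CoveringFrame.
Context {R : realType} {m : nat} {G M : topologicalType}.
Variables (AG : set (chart R m G)) (JG : endo_field (R := R) (M := G)).
Variables (gG : bilinear_field (R := R) (M := G)).
Variables (AM : set (chart R m M)) (JM : endo_field (R := R) (M := M)).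
Variables (gM : bilinear_field (R := R) (M := M)) (prj : G -> M).
Hypotheses (manG : is_manifold AG) (manM : is_manifold AM).
Hypothesis cov : universal_hermitian_cover AG JG gG AM JM gM prj.
Variables (E : 'rV[R]_m -> vfield R G) (gV : 'rV[R]_m -> 'rV[R]_m -> R).
Variables (JV : 'rV[R]_m -> 'rV[R]_m) (bV : 'rV[R]_m -> 'rV[R]_m -> 'rV[R]_m).
Hypothesis fr : invariant_frame AG JG gG setT E gV JV bV.

(** [V] is a sheet over an evenly covered neighbourhood [U], and [s] inverts [prj] between them. The
    openness of [V] is what permits germs at [s x] to be compared through [s]. *)
Lemma covering_section p : exists U (V : set G) (s : M -> G), [/\ open U, U p,
  open V, forall x, U x -> V (s x) /\ prj (s x) = x &
  forall y, V y -> U (prj y) /\ s (prj y) = y].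
Proof.
have [_ surj even] := uc_covering cov; have [U [oU Up [S [SP _ SU]]]] := even p.
have [q qp] := surj p.
have [V SV Vq] : (\bigcup_(V in S) V) q by rewrite -SU /= qp.
have [oV [VU Vinj Vsurj] _] := SP V SV.
have /choice[s sP] : forall x : M, exists y : G, U x -> V y /\ prj y = x.
  (* Outside [U] the section takes the arbitrary value [q]. *)
  move=> x; have [Ux|nUx] := pselect (U x); last by exists q.
  by have [y Vy yx] := Vsurj _ Ux; exists y.
exists U, V, s; split=> // y Vy; have Uy : U (prj y) by exact: VU.
split=> //; have [Vs sy] := sP _ Uy.
by apply: Vinj; rewrite ?inE.
Qed.

Lemma covering_smooth_map q : smooth_map_at AG AM prj q.
Proof.
have [cont _ _] := uc_covering cov; split; first exact: cont.
by move=> f; exact: (uc_local_diffeo cov q f).1.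
Qed.

Lemma covering_frame p : exists U EM,
  [/\ open U, U p & invariant_frame AM JM gM U EM gV JV bV].
Proof.
have [U [V [s [oU Up oV sP prjP]]]] := covering_section p.
pose EM u x := Defs.pushforward AM prj (s x) (E u (s x)).
have nearV x : U x -> \forall y \near s x, V y.
  by move=> /sP[Vs _]; apply: open_nbhs_nbhs.
have tE u y : tangent AG y (E u y).
  by apply: smooth_field_tangent; exact: (fr_smooth fr).
have tEM u x : U x -> tangent AM x (EM u x).
  move=> Ux; have [_ sx] := sP _ Ux; rewrite -{1}sx.
  by apply: (pushforward_tangent manG manM) => //; exact: covering_smooth_map.
have EME u x f : U x -> smooth_at AM x f -> EM u x f = E u (s x) (f \o prj).
  by move=> Ux sf; rewrite /EM pushforwardE//; rewrite (sP _ Ux).2.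
have lift x f : U x -> smooth_at AM x f -> smooth_at AG (s x) (f \o prj).
  by move=> Ux sf; apply: (uc_local_diffeo cov _ _).1; rewrite (sP _ Ux).2.
(* On the sheet [V] the section undoes [prj], so applying [EM u] downstairs and pulling back is the
   same as applying [E u] to the pullback. Smoothness and brackets on [M] thereby reduce to those on
   [G]. *)
have nearEM u x f : U x -> smooth_at AM x f ->
    \forall y \near s x, ((fun z => EM u z f) \o prj) y = E u y (f \o prj).
  move=> Ux sf; near=> y.
  have Vy : V y by near: y; exact: nearV.
  have [Uy sy] := prjP _ Vy.
  rewrite /= EME//; first by rewrite sy.
  apply: (uc_local_diffeo cov _ _).2.
  by near: y; apply: (smooth_at_near manG); exact: lift.
have sEM u x : U x -> smooth_field_at AM x (EM u).
  move=> Ux; split.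
    near=> y; apply: tEM; near: y; apply: open_nbhs_nbhs; by split.
  move=> f sf; rewrite -(sP _ Ux).2; apply: (uc_local_diffeo cov _ _).2.
  apply: (smooth_at_eq manG (f := fun y => E u y (f \o prj))).
    by move: (nearEM u _ _ Ux sf); apply: filterS => y ->.
  by have [_] := fr_smooth fr u (I : setT (s x)); apply; exact: lift.
exists U, EM; split=> //; split=> [a u v x|//|u v x Ux|u x Ux|u v x Ux].
- by rewrite /EM (fr_linear fr) pushforward_linear.
- by have := uc_isometric cov (tE u (s x)) (tE v (s x));
  rewrite (sP _ Ux).2 (fr_metric fr).
- by have := uc_holomorphic cov (tE u (s x)); rewrite (sP _ Ux).2 (fr_endo fr).
apply/funext => f; have [sf|sf] := pselect (smooth_at AM x f); last first.
  by rewrite bracket_not_smooth// (tangent_not_smooth (tEM _ _ Ux) sf).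
have sEf w : smooth_at AM x (fun y => EM w y f).
  by have [_] := sEM w _ Ux; exact.
rewrite bracketE// !EME// (tvec_eq manG (tE u (s x)) (nearEM v _ _ Ux sf)).
rewrite (tvec_eq manG (tE v (s x)) (nearEM u _ _ Ux sf)).
by rewrite -(bracketE (E u) (E v) (lift _ _ Ux sf)) (fr_bracket fr).
Unshelve. all: by end_near. Qed.

End CoveringFrame.

Theorem theorem3 (R : realType) (n : nat) (n_gt0 : (0 < n)%N)
  (* the Hermitian manifold M of complex dimension n *)
  (M : topologicalType) (AM : set (chart R n.*2 M))
  (JM : endo_field (R := R) (M := M)) (gM : bilinear_field (R := R) (M := M))
  (hermM : is_hermitian AM JM gM)
  (* the nilpotent Lie group G with its left-invariant Hermitian structure *)
  (G : groupSpaceType) (AG : set (chart R n.*2 G))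
  (JG : endo_field (R := R) (M := G)) (gG : bilinear_field (R := R) (M := G))
  (lieG : is_lie_group AG) (nilG : nilpotent_group G)
  (hermG : is_hermitian AG JG gG)
  (invJ : left_invariant_endo AG JG) (invg : left_invariant_metric AG gG)
  (nilJ : nilpotent_complex_structure AG JG)
  (prj : G -> M) (coverM : universal_hermitian_cover AG JG gG AM JM gM prj)
  (* the Strominger connection of M *)
  (Ds : covariant_op (R := R) (M := M)) (stromD : is_strominger AM JM gM Ds)
  (f : M -> R) (Hs : hol_sect_curv_eq AM JM gM Ds f) :
  [/\ forall p, f p = 0, is_kahler AM JM gM, is_flat AM gM &
      forall x y : G, (x * y)%g = (y * x)%g].
Proof.
have manG := lie_manifold lieG; have manM := herm_manifold hermM.
have [c Ac c1] := man_cover manG (1%g : G).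
have [gV [JV [bV [gP JP bP fr]]]] := linv_frameP lieG hermG invJ invg Ac c1.
have [K flagK] := J_ascending_flag lieG Ac c1 nilJ gP JP bP fr.
have [k [e [eP _ eE']]] := orthonormal_basis gP (S := setT) I (fun _ _ _ _ _
  => I).
have {eE'}eE v : v = \sum_i gV v (e i) *: e i by exact: eE'.
(* Positivity of [n] supplies a nonzero vector, from which a flat direction [u0] is obtained. *)
pose v0 : 'rV[R]_(n.*2) := const_mx 1.
have v0_neq0 : v0 <> 0.
  have n2 : (0 < n.*2)%N by rewrite double_gt0.
  move/rowP => /(_ (Ordinal n2)); rewrite !mxE => /eqP; rewrite oner_eq0//.
have [u0 u0_neq0 Ku0] := hol_curv_flat_vector gP JP eE bP flagK v0_neq0.
(* The right-hand side does not involve [p]: the structure constants of [G] serve at every point of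
   [M]. Hence [f] is constant, and [u0] shows that the constant is 0. *)
have fK p u : u <> 0 -> f p = hol_curv gV JV e bV u / gV u u ^+ 2.
  move=> u_neq0; have [U [E [oU Up frM]]] := covering_frame manG manM coverM
    fr p.
  have EN w x : E (- w) x = - E w x.
    have E00 : E 0 x = 0.
      have := fr_linear frM 1 0 0 x; rewrite !scale1r addr0 => /eqP.
      by rewrite eq_sym -subr_eq0 addrK => /eqP.
    by have := fr_linear frM (-1) w 0 x; rewrite !addr0 !scaleN1r E00 addr0.
  have := Hs p (E u, E (- JV u)) (fr_smooth frM u Up) (fr_smooth frM (- JV u)
    Up).
  rewrite (hol_sect_curv_frame hermM stromD oU frM gP JP bP eE Up u_neq0) => H.
  apply/esym/(fmorph_inj (real_complex R)); apply: H.
    rewrite /type10_at /= !(fr_endo frM)// !EN opprK; split=> //.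
    by rewrite (ceN JP) (ce_square JP) opprK.
  move=> [Eu0 _]; apply: u_neq0; apply: (ip_eq0 gP).
  have rg := herm_riemannian hermM.
  rewrite -(fr_metric frM u u Up) Eu0.
  have := rm_linear rg 1 (tangent0 manM p) (tangent0 manM p) (tangent0 manM p).
  by rewrite scaler0 addr0 mul1r => /eqP;
    rewrite eq_sym -subr_eq0 addrK => /eqP.
have f0 p : f p = 0 by rewrite (fK p u0)// Ku0 mul0r.
have [_ surj _] := uc_covering coverM.
have K0 x : 0 <= hol_curv gV JV e bV x.
  have [->|/eqP x0] := eqVneq x 0.
    (* The zero vector, for which the sectional curvature is undefined, is treated as an element of
       the trivial central subspace. *)
    rewrite (hol_curv_vertical gP JP eE bP (S := [set 0]))// => [w ->|w z ->].
      exact: (ce0 JP).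
    exact: (ib0l bP).
  have := fK (prj 1%g) x x0; rewrite f0 => /esym/eqP.
  rewrite mulf_eq0 invr_eq0 expf_eq0/= (gt_eqF (ip_gt0 gP x0)) orbF.
  by move=> /eqP ->.
have b0 := nilpotent_hol_curv_ge0_abelian gP JP eE bP flagK K0.
have tor p X Y : smooth_field_at AM p X -> smooth_field_at AM p Y ->
    torsion AM Ds X Y p = 0.
  have [U [E [oU Up frM]]] := covering_frame manG manM coverM fr p.
  exact: (torsion_abelian_frame hermM stromD oU frM gP JP bP eE b0 Up).
split=> //.
- exact: (strominger_torsion_free_kahler hermM stromD tor).
(* Being metric and torsion free, the Strominger connection is itself the Levi-Civita connection, so
   its curvature decides flatness. *)
- exists Ds; first by split=> //;
  [exact: (st_connection stromD)|exact: (st_metric stromD)].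
  move=> p X Y Z; have [U [E [oU Up frM]]] := covering_frame manG manM coverM
    fr p.
  exact: (curvature_abelian_frame hermM stromD oU frM gP JP bP eP eE b0 Up).
- have scG := uc_simply_connected coverM.
  exact: (abelian_commutative lieG hermG Ac c1 scG gP fr b0).
Qed.
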